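(* Let $M(x)=\sum_{n\le x}\mu(n)$ for real $x\ge 1$, and let $H(x)=e^{-\sqrt{x}}\,M\left(e^{\sqrt{x}}\right)$ for real $x\ge 0$. Then $$\lim_{x\to+\infty}H(x)=0.$$
   Context: Here $\mu$ denotes the Möbius function, and sums over $n\le x$ run over positive integers $n\le x$. By the change of variable $x\mapsto e^{\sqrt{x}}$, the conclusion is the statement $\lim_{x\to+\infty}M(x)/x=0$. *)

(* Defs.v *)
From mathcomp Require Import all_boot all_order all_algebra.
From mathcomp Require Import all_classical all_reals all_analysis.

Set Implicit Arguments.
Unset Strict Implicit.
Unset Printing Implicit Defensive.

Import Order.TTheory GRing.Theory Num.Theory.
Import numFieldNormedType.Exports.

Local Open Scope ring_scope.

(* No prime square divides n; 0 must be excluded by hand, as primes 0 = [::]. *)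
Definition squarefree (n : nat) : bool :=
  (0 < n)%N && all (fun p => ~~ (p ^ 2 %| n)%N) (primes n).

(* primes n lists the distinct prime divisors of n. The value at n = 0 is 0. *)
Definition moebius (n : nat) : int :=
  if squarefree n then (-1) ^+ size (primes n) else 0.

(* For 0 <= x, Num.truncn x is the integer part of x, so the index n ranges
   over the positive integers with n <= x; for x < 1 the sum is empty. *)
Definition M (R : realType) (x : R) : R :=
  \sum_(1 <= n < (Num.truncn x).+1) (moebius n)%:~R.

(* Meaningful for 0 <= x; the values at x < 0, where Num.sqrt x = 0, do not
   affect the limit at +oo. *)
Definition H (R : realType) (x : R) : R :=
  expR (- Num.sqrt x) * M (expR (Num.sqrt x)).

(* Main.v *)
Require Import Defs.
From mathcomp Require Import all_boot all_order all_algebra.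
From mathcomp Require Import all_classical all_reals all_analysis.
From mathcomp Require Import ring lra zify.
Import Order.TTheory GRing.Theory Num.Theory.
Import numFieldNormedType.Exports.
Local Open Scope classical_set_scope.
Local Open Scope ring_scope.

(* Selberg's method applied to the Moebius function. Write L for the logarithm,
   * for Dirichlet convolution and Lambda for the von Mangoldt function. Since
   multiplication by L is a derivation of *, one has
   L^2 mu = mu * (Lambda * Lambda - L Lambda), and Selberg's formula says that
   L Lambda + Lambda * Lambda has the same summatory function as 2 L up to O(N);
   as M is 1-Lipschitz, a summation by parts gives
     |M(N)| ln^2 N <= 2 sum_(n <= N) ln n |M(N/n)| + O(N ln N).
   If |M(k)| <= be k for large k, the right-hand side is at most
   be N ln^2 N + O(N ln N). A gain is available on every block a < n <= K a:
   the sum of M(N/n) over the block is O(N), which is small against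
   sum N/n ~ N ln K, so either M(N/n) has constant sign on the block and |M| is
   small in mean, or M changes sign and is small near the sign change. Hence
   be may be replaced by be - de, with de depending only on a positive lower
   bound of be, and by iteration every be > 0 is reached. *)

Set Implicit Arguments.
Unset Strict Implicit.
Unset Printing Implicit Defensive.

(** * Reindexing of sums over initial segments of the positive integers *)

Lemma sum_nat_extend (V : nmodType) (n B : nat) (F : nat -> V) :
  (n <= B)%N -> (forall i, (n < i)%N -> F i = 0) ->
  \sum_(1 <= i < n.+1) F i = \sum_(1 <= i < B.+1) F i.
Proof.
move=> nB F0; rewrite [RHS](big_cat_nat (n:=n.+1))//=.
by rewrite [X in _ + X]big_nat [X in _ + X]big1 ?addr0// => i /andP[+ _]; exact: F0.
Qed.

(** The dependence on [a] moves from the range into a condition, so that sums over [a] and [b] can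
    be exchanged. *)
Lemma sum_nat_div (V : nmodType) (N B a : nat) (F : nat -> V) :
  (0 < a)%N -> (N <= B)%N ->
  \sum_(1 <= b < (N %/ a).+1) F b = \sum_(1 <= b < B.+1 | (a * b <= N)%N) F b.
Proof.
move=> a0 NB; rewrite [RHS]big_mkcond/=.
rewrite -(@sum_nat_extend _ (N %/ a)%N B); last 2 first.
- exact: (leq_trans (leq_div _ _) NB).
- by move=> i; rewrite ltn_divLR// mulnC ltnNge => /negbTE ->.
by apply: eq_big_nat => b /andP[_]; rewrite ltnS leq_divRL// mulnC => ->.
Qed.

Lemma sum_nat_pick (V : nmodType) (N k : nat) (F : nat -> V) :
  (0 < k)%N -> \sum_(1 <= n < N.+1 | k == n) F n = if (k <= N)%N then F k else 0.
Proof.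
move=> k0; rewrite -big_filter.
case: ifP => kN.
  rewrite (_ : [seq _ <- _ | _] = [:: k]) ?big_seq1//.
  have -> : [seq i <- index_iota 1 N.+1 | k == i] = [seq i <- index_iota 1 N.+1 | pred1 k i].
    by apply: eq_filter => i /=; rewrite eq_sym.
  by rewrite filter_pred1_uniq ?iota_uniq// mem_index_iota k0 ltnS.
rewrite big_filter big_nat_cond big1// => i /andP[/andP[_ iN] /eqP ki].
by move: kN; rewrite ki -ltnS iN.
Qed.

(** * Dirichlet convolution *)

Section dirichlet_convolution.
Context {R : comNzRingType}.
Implicit Types f g h : nat -> R.

(** Summing over pairs with product [n], rather than over divisors, reduces commutativity and
    associativity to exchanges of sums. At [n = 0] the range is empty. *)
Definition dconv f g (n : nat) : R :=
  \sum_(1 <= a < n.+1) \sum_(1 <= b < n.+1 | (a * b)%N == n) f a * g b.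

(** Both factors of a positive [n] are at most [n], and no positive pair has product 0. *)
Lemma dconv_widen f g n B : (n <= B)%N ->
  dconv f g n = \sum_(1 <= a < B.+1) \sum_(1 <= b < B.+1 | (a * b)%N == n) f a * g b.
Proof.
move=> nB; rewrite /dconv.
have [->|n0] := posnP n.
  rewrite big_nil big_nat_cond big1// => a /andP[/andP[a0 _] _].
  rewrite big_nat_cond big1// => b /andP[/andP[b0 _]].
  by rewrite muln_eq0; case: a b a0 b0 => [|?] [|?].
transitivity (\sum_(1 <= a < n.+1) \sum_(1 <= b < B.+1 | (a * b)%N == n) f a * g b).
  apply: eq_big_nat => a /andP[a0 _].
  rewrite big_mkcond [RHS]big_mkcond/=.
  apply: sum_nat_extend => // b nb; case: ifPn => // /eqP abn.
  by move: nb; rewrite -abn ltnNge leq_pmull.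
apply: sum_nat_extend => // a na.
rewrite big_nat_cond big1// => b /andP[/andP[b0 _] /eqP abn].
by move: na; rewrite -abn ltnNge leq_pmulr.
Qed.

Lemma sum_dconv f g N :
  \sum_(1 <= n < N.+1) dconv f g n =
  \sum_(1 <= a < N.+1) f a * \sum_(1 <= b < (N %/ a).+1) g b.
Proof.
under eq_big_nat => n /andP[_ nN] do rewrite (@dconv_widen _ _ _ N)//.
rewrite exchange_big_nat/=; apply: eq_big_nat => a /andP[a0 _].
rewrite (@sum_nat_div _ N N)// big_distrr/=.
under eq_bigr do rewrite big_mkcond/=.
rewrite exchange_big_nat/= [RHS]big_mkcond/=; apply: eq_big_nat => b /andP[b0 _].
by rewrite -big_mkcond/= sum_nat_pick// muln_gt0 a0.
Qed.

Lemma dconvC f g : dconv f g =1 dconv g f.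
Proof.
move=> n; rewrite /dconv.
under eq_bigr do rewrite big_mkcond/=.
rewrite exchange_big_nat/=; apply: eq_bigr => a _; rewrite [RHS]big_mkcond/=.
by apply: eq_bigr => b _; rewrite mulnC mulrC.
Qed.

(** A form in which the bracketing is no longer visible; associativity then follows by commutativity
    and renaming. *)
Lemma dconv_convl f g h n : dconv (dconv f g) h n =
  \sum_(1 <= a < n.+1) \sum_(1 <= b < n.+1) \sum_(1 <= c < n.+1)
    if (a * b * c)%N == n then f a * g b * h c else 0.
Proof.
rewrite {1}/dconv.
transitivity (\sum_(1 <= e < n.+1) \sum_(1 <= c < n.+1) \sum_(1 <= a < n.+1)
  \sum_(1 <= b < n.+1)
    if ((a * b == e) && (e * c == n))%N then f a * g b * h c else 0).
  apply: eq_big_nat => e /andP[e0 eN]; rewrite big_mkcond/=.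
  apply: eq_big_nat => c _; rewrite (@dconv_widen _ _ _ n)//.
  case: ifP => _; last first.
    by rewrite big1// => a _; rewrite big1// => b _; rewrite andbF.
  rewrite big_distrl/=; apply: eq_bigr => a _; rewrite big_distrl big_mkcond/=.
  by apply: eq_bigr => b _; rewrite andbT.
rewrite exchange_big_nat/=.
under eq_bigr do rewrite exchange_big_nat/=.
rewrite exchange_big_nat/=; apply: eq_big_nat => a /andP[a0 _].
under eq_bigr do rewrite exchange_big_nat/=.
rewrite exchange_big_nat/=; apply: eq_big_nat => b /andP[b0 _].
apply: eq_big_nat => c /andP[c0 _].
under eq_bigr do rewrite if_and.
(* Picking the intermediate product [e = a * b] loses no term: it is at most [n] whenever
   [a * b * c = n]. *)
rewrite -big_mkcond/= sum_nat_pick ?muln_gt0 ?a0//.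
case: ifPn => // abn; case: ifPn => // /eqP E.
by case/negP: abn; rewrite -E leq_pmulr.
Qed.

Lemma dconvA f g h : dconv f (dconv g h) =1 dconv (dconv f g) h.
Proof.
move=> n; rewrite dconvC !dconv_convl.
under eq_bigr do rewrite exchange_big_nat/=.
rewrite exchange_big_nat/=; apply: eq_bigr => a _.
apply: eq_bigr => b _; apply: eq_bigr => c _.
by rewrite (_ : b * c * a = a * b * c)%N 1?mulnC ?mulnA// mulrC mulrA.
Qed.

Lemma eq_dconv {f f' g g'} : f =1 f' -> g =1 g' -> dconv f g =1 dconv f' g'.
Proof.
by move=> ff gg n; apply: eq_bigr => a _; apply: eq_bigr => b _; rewrite ff gg.
Qed.

Lemma dconvDl f f' g : dconv (f \+ f') g =1 dconv f g \+ dconv f' g.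
Proof.
move=> n; rewrite /dconv /= -big_split/=; apply: eq_bigr => a _.
by rewrite -big_split/=; apply: eq_bigr => b _; rewrite mulrDl.
Qed.

Lemma dconvNl f g : dconv (\- f) g =1 \- dconv f g.
Proof.
move=> n; rewrite /dconv /= -sumrN; apply: eq_bigr => a _.
by rewrite -sumrN; apply: eq_bigr => b _; rewrite mulNr.
Qed.

Definition dunit (n : nat) : R := (n == 1)%:R.
Definition dconst1 (n : nat) : R := (0 < n)%:R.

(** The hypothesis at 0 matches the fact that every convolution vanishes there. *)
Lemma dconv_dunitl f : f 0 = 0 -> dconv dunit f =1 f.
Proof.
move=> f0 [|n]; first by rewrite /dconv big_nil.
rewrite /dconv big_ltn// [X in _ + X]big_nat [X in _ + X]big1 ?addr0; last first.
  move=> [|[|i]]//= _; rewrite big1// => j _; by rewrite /dunit mul0r.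
under eq_bigl do rewrite mul1n eq_sym.
by rewrite sum_nat_pick// leqnn /dunit mul1r.
Qed.

Lemma dconv_dconst1 f n : dconv f dconst1 n = \sum_(1 <= a < n.+1 | (a %| n)%N) f a.
Proof.
rewrite /dconv [RHS]big_mkcond/=; apply: eq_big_nat => a /andP[a0 aN].
case: ifP => [/dvdnP[k kE]|andvd].
  have k0 : (0 < k)%N by case: k kE aN => // ->; rewrite mul0n ltnS leqNgt a0.
  under eq_bigl => b do rewrite kE mulnC eqn_pmul2r// eq_sym.
  rewrite sum_nat_pick// ifT ?kE ?leq_pmulr// /dconst1 k0 mulr1//.
rewrite big1// => b /eqP E; move: andvd; by rewrite -E dvdn_mulr.
Qed.

(** On each pair with [a * b = n], additivity splits [L n] into [L a + L b]. *)
Lemma dconv_derivation (L : nat -> R) f g :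
  (forall a b, (0 < a)%N -> (0 < b)%N -> L (a * b)%N = L a + L b) ->
  L \* dconv f g =1 dconv (L \* f) g \+ dconv f (L \* g).
Proof.
move=> LM n; rewrite /dconv /= big_distrr -big_split/=.
apply: eq_big_nat => a /andP[a0 _]; rewrite big_distrr -big_split/=.
rewrite big_nat_cond [RHS]big_nat_cond.
apply: eq_bigr => b /andP[/andP[b0 _] /eqP <-]; rewrite LM//; ring.
Qed.

End dirichlet_convolution.

(** * The Moebius and von Mangoldt functions *)

Lemma squarefreeP n : reflect ((0 < n)%N /\ forall p, prime p -> ~~ (p ^ 2 %| n)%N)
  (squarefree n).
Proof.
apply: (iffP andP) => -[n0].
  move=> /allP sq; split=> // p pp; apply/negP => p2n.
  have /sq : p \in primes n; last by rewrite p2n.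
  by rewrite mem_primes pp n0 (dvdn_trans _ p2n)// expnS dvdn_mulr.
by move=> sq; split=> //; apply/allP => p; rewrite mem_primes => /andP[/sq].
Qed.

Lemma moebius_prime_mul_dvd p d : prime p -> (p %| d)%N -> moebius (p * d) = 0.
Proof.
move=> pp pd; rewrite /moebius; case: squarefreeP => // -[_ /(_ _ pp)].
by rewrite expnS expn1 dvdn_pmul2l ?prime_gt0// pd.
Qed.

Lemma moebius_prime_mul p d : prime p -> ~~ (p %| d)%N -> moebius (p * d) = - moebius d.
Proof.
move=> pp pd; have d0 : (0 < d)%N by case: d pd => //; rewrite dvdn0.
have p0 := prime_gt0 pp.
have sqE : squarefree (p * d) = squarefree d.
  apply/squarefreeP/squarefreeP => -[_ sq]; split; rewrite ?muln_gt0 ?p0//.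
    by move=> q /sq; apply: contra => /dvdn_mull.
  move=> q pq; have [<-|qp] := eqVneq p q.
    by rewrite expnS expn1 dvdn_pmul2l.
  rewrite Gauss_dvdr ?sq// coprime_sym coprimeXr// prime_coprime//.
  by rewrite dvdn_prime2.
rewrite /moebius sqE; case: ifP => _; last by rewrite oppr0.
have /perm_size -> : perm_eq (primes (p * d)) (p :: primes d).
  apply: uniq_perm; rewrite ?primes_uniq//= ?mem_primes ?(negbTE pd) ?andbF ?primes_uniq//.
  by move=> q; rewrite primesM// primes_prime// !inE.
by rewrite exprS mulN1r.
Qed.

(** A divisor of [p * m] prime to [p] divides [m]; any other is [p] times a divisor of [m]. For the
    Moebius function the two families cancel. *)
Lemma sum_dvdn_prime_mul (V : nmodType) p m (F : nat -> V) : prime p -> (0 < m)%N ->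
  \sum_(1 <= d < (p * m).+1 | (d %| p * m)%N) F d =
  \sum_(1 <= d < m.+1 | (d %| m)%N && ~~ (p %| d)%N) F d +
  \sum_(1 <= d < m.+1 | (d %| m)%N) F (p * d)%N.
Proof.
move=> pp m0; have p0 := prime_gt0 pp.
rewrite (bigID (fun d => (p %| d)%N))/= addrC; congr (_ + _).
  rewrite big_mkcond [RHS]big_mkcond/=.
  transitivity (\sum_(1 <= d < (p * m).+1)
      if (d %| m)%N && ~~ (p %| d)%N then F d else 0).
    apply: eq_big_nat => d _; case: (boolP (p %| d)%N); rewrite ?andbF// => pd.
    by rewrite !andbT Gauss_dvdr// coprime_sym prime_coprime.
  apply/esym/sum_nat_extend; first by rewrite leq_pmull.
  by move=> i mi; case: ifP => // /andP[/dvdn_leq]; rewrite m0 leqNgt mi => /(_ isT).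
rewrite big_mkcond [RHS]big_mkcond/=.
pose G d := if (d %| p * m)%N then F d else 0.
transitivity (\sum_(1 <= e < ((p * m) %/ p).+1) G (p * e)%N); last first.
  by rewrite mulKn//; apply: eq_bigr => e _; rewrite /G dvdn_pmul2l.
rewrite (@sum_nat_div _ _ (p * m)%N)//.
transitivity (\sum_(1 <= e < (p * m).+1 | (p * e <= p * m)%N)
   \sum_(1 <= d < (p * m).+1 | (p * e)%N == d) G d); last first.
  rewrite big_nat_cond [RHS]big_nat_cond; apply: eq_bigr => e /andP[/andP[e0 _] pe].
  by rewrite sum_nat_pick ?muln_gt0 ?p0// pe.
rewrite big_mkcond [RHS]big_mkcond/=.
transitivity (\sum_(1 <= e < (p * m).+1) \sum_(1 <= d < (p * m).+1)
    if (p * e == d)%N then G d else 0); last first.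
  apply: eq_big_nat => e /andP[e0 _]; rewrite -big_mkcond/=.
  by rewrite sum_nat_pick ?muln_gt0 ?p0//; case: ifP.
(* For fixed [d] the only possible [e] is the quotient of [d] by [p]. *)
rewrite exchange_big_nat/=; apply: eq_big_nat => d /andP[d0 dm].
case: (boolP (p %| d)%N) => [/dvdnP[k kE]|pd]; last first.
  rewrite andbF big1// => e _; case: eqP => // pe.
  by case/negP: pd; rewrite -pe dvdn_mulr.
have k0 : (0 < k)%N by case: k kE d0 => // ->.
transitivity (\sum_(1 <= e < (p * m).+1 | k == e) G d).
  have -> : \sum_(1 <= e < (p * m).+1 | k == e) G d = G d; last by rewrite andbT.
  by rewrite sum_nat_pick// ifT// -ltnS (leq_trans _ dm)// ltnS kE leq_pmulr.
rewrite big_mkcond; apply: eq_bigr => e _.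
by rewrite kE (mulnC k) eqn_pmul2l// eq_sym.
Qed.

Section moebius_mangoldt.
Context {R : realType}.

Definition mu (n : nat) : R := (moebius n)%:~R.

Definition lnn (n : nat) : R := ln n%:R.

(* At most one pair (p, k) contributes, since n = p ^ k determines it. *)
Definition mangoldt (n : nat) : R :=
  \sum_(1 <= p < n.+1 | prime p) \sum_(1 <= k < n.+1 | (p ^ k == n)%N) lnn p.

Lemma norm_mu_le1 n : `|mu n| <= 1.
Proof.
by rewrite /mu /moebius; case: ifP => _; rewrite ?rmorphXn/= ?normr0// ?normrX ?rmorphN1 ?normrN1 ?expr1n.
Qed.

(** Let [p] be the least prime factor of [n = p * m]. For [d] dividing [m], the terms at [d] and
    [p * d] cancel if [p] does not divide [d]; otherwise the term at [p * d] is 0. *)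
Lemma dconv_mu_dconst1 : dconv mu dconst1 =1 dunit.
Proof.
move=> n; rewrite dconv_dconst1 /dunit.
have [->|n0] := posnP n; first by rewrite big_nil.
have [->|n1] := eqVneq n 1%N.
  by rewrite big_mkcond/= big_nat1 dvd1n /mu/moebius/squarefree/= expr0.
have n1' : (1 < n)%N by case: n n0 n1 => [|[|]].
have pp := pdiv_prime n1'; set p := pdiv n in pp.
have /dvdnP[m nE] : (p %| n)%N := pdiv_dvd n.
have m0 : (0 < m)%N by case: m nE n0 => // ->.
rewrite nE mulnC sum_dvdn_prime_mul// [X in _ + X](bigID (fun d => (p %| d)%N))/=.
rewrite [X in _ + (X + _)]big1 ?add0r -?big_split/=; last first.
  by move=> d /andP[_ pd]; rewrite /mu moebius_prime_mul_dvd.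
by rewrite big1// => d /andP[_ pd]; rewrite /mu moebius_prime_mul// rmorphN subrr.
Qed.

Lemma lnnM a b : (0 < a)%N -> (0 < b)%N -> lnn (a * b) = lnn a + lnn b.
Proof. by move=> a0 b0; rewrite /lnn natrM lnM ?posrE ?ltr0n. Qed.

Lemma lnn_ge0 n : 0 <= lnn n.
Proof.
case: n => [|n]; first by rewrite /lnn ln0.
by rewrite /lnn ln_ge0// ler1n.
Qed.

Lemma ler_lnn m n : (m <= n)%N -> lnn m <= lnn n.
Proof.
case: m => [|m] mn; first by rewrite {1}/lnn ln0// lnn_ge0.
by rewrite /lnn ler_ln ?posrE ?ltr0n ?ler_nat// (leq_trans _ mn).
Qed.

Lemma mangoldt_ge0 n : 0 <= mangoldt n.
Proof. by apply: sumr_ge0 => p _; apply: sumr_ge0 => k _; exact: lnn_ge0. Qed.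

Lemma lnn_prod (s : seq nat) (F : nat -> nat) : all (fun i => 0 < F i)%N s ->
  lnn (\prod_(i <- s) F i) = \sum_(i <- s) lnn (F i).
Proof.
elim: s => [|i s IH]; first by rewrite !big_nil /lnn ln1.
by move=> /= /andP[i0 s0]; rewrite !big_cons lnnM ?IH// big_seq prodn_cond_gt0// => j /(allP s0).
Qed.

Lemma lnn_sum_logn n : (0 < n)%N -> lnn n = \sum_(1 <= p < n.+1) lnn p *+ logn p n.
Proof.
move=> n0; rewrite -[in LHS](partnT n0) /partn.
rewrite big_ltn//= lognE/= mul1n lnn_prod; last first.
  by apply/allP => p; rewrite mem_index_iota expn_gt0 => /andP[->].
apply: eq_big_nat => p /andP[p0 _].
by rewrite /lnn natrX lnXn// ltr0n.
Qed.

(** For each prime [p] there are [logn p n] exponents [k >= 1] with [p ^ k] dividing [n], each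
    contributing [ln p]; the factorization of [n] gives the total. *)
Lemma dconv_mangoldt_dconst1 : dconv mangoldt dconst1 =1 lnn.
Proof.
move=> n; rewrite dconv_dconst1.
have [->|n0] := posnP n; first by rewrite big_nil /lnn ln0.
rewrite lnn_sum_logn//.
transitivity (\sum_(1 <= d < n.+1) \sum_(1 <= p < n.+1) \sum_(1 <= k < n.+1 | (p ^ k == d)%N)
   if prime p && (d %| n)%N then lnn p else 0).
  rewrite big_mkcond; apply: eq_big_nat => d /andP[d0 dn].
  case: ifPn => dvdn; last by rewrite big1// => p _; rewrite big1// andbF.
  rewrite /mangoldt big_mkcond.
  (* The ranges of [p] and [k] are widened from [d] to [n] before the exchange: [p ^ k = d] forces
     [p <= d] and [k < d]. *)
  rewrite (@sum_nat_extend _ d n)//=; last first.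
    move=> p dp; case: ifP => // pp; rewrite big_nat_cond big1// => k /andP[/andP[k0 _] /eqP pk].
    move: dp; rewrite -pk ltnNge -[X in (X <= _)%N]expn1 leq_pexp2l//.
    exact: prime_gt0.
  apply: eq_bigr => p _; case: ifP => pp/=; last by rewrite big1.
  rewrite big_mkcond [RHS]big_mkcond/=; apply: sum_nat_extend => // k dk.
  case: eqP => // pk; move: dk; rewrite -pk ltnNge (ltnW (ltn_expl _ _))//.
  exact: prime_gt1.
rewrite exchange_big_nat/=; apply: eq_big_nat => p /andP[p0 _].
under eq_bigr do rewrite big_mkcond/=.
rewrite exchange_big_nat/=.
have [pp|npp] := boolP (prime p); last first.
  rewrite lognE (negbTE npp)/= mulr0n big1// => k _.
  by rewrite big1// => d _; case: ifP.
have p1 := prime_gt1 pp.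
transitivity (\sum_(1 <= k < n.+1) if (k <= logn p n)%N then lnn p else 0).
  apply: eq_big_nat => k _; rewrite -big_mkcond/= sum_nat_pick ?expn_gt0 ?p0//.
  rewrite -pfactor_dvdn//; case: (boolP (p ^ k %| n)%N) => [dn|].
    by rewrite dvdn_leq.
  by case: ifP.
rewrite -(@sum_nat_extend _ (logn p n)); last 2 first.
- by rewrite (leq_trans (ltnW (ltn_expl _ p1)))// dvdn_leq// pfactor_dvdnn.
- by move=> k; rewrite ltnNge => /negbTE ->.
rewrite big_nat (eq_bigr (fun=> lnn p)); last by move=> k /andP[_]; rewrite ltnS => ->.
by rewrite -big_nat sumr_const_nat subn1.
Qed.

End moebius_mangoldt.

(** * Convolution identities behind Selberg's formula *)

Section selberg_identities.
Context {R : realType}.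
Local Notation mu := (@mu R).
Local Notation lnn := (@lnn R).
Local Notation mangoldt := (@mangoldt R).

Definition mertens (k : nat) : R := \sum_(1 <= n < k.+1) mu n.

Definition selberg (n : nat) : R := lnn n * mangoldt n + dconv mangoldt mangoldt n.

Lemma moebius_inversion (f g : nat -> R) : f 0 = 0 ->
  dconv f dconst1 =1 g -> f =1 dconv mu g.
Proof.
move=> f0 fg n.
rewrite -(eq_dconv (frefl mu) fg) (eq_dconv (frefl mu) (dconvC f dconst1)).
by rewrite dconvA (eq_dconv dconv_mu_dconst1 (frefl f)) dconv_dunitl.
Qed.

Lemma lnn0 : lnn 0 = 0. Proof. by rewrite /lnn ln0. Qed.

Lemma lnn_dconst1 : lnn \* dconst1 =1 lnn.
Proof. by case=> [|k] /=; rewrite /dconst1 ?mulr1// mulr0 lnn0. Qed.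

(** The derivation L applied to Lambda * 1 = L gives L^2 = (L Lambda) * 1 + Lambda * L, and the last
    L is again Lambda * 1. *)
Lemma dconv_selberg_dconst1 : dconv selberg dconst1 =1 lnn \* lnn.
Proof.
move=> n; have /= := dconv_derivation mangoldt dconst1 (@lnnM R) n.
rewrite dconv_mangoldt_dconst1 => ->.
rewrite [LHS](@dconvDl _ (lnn \* mangoldt) (dconv mangoldt mangoldt))/=; congr (_ + _).
rewrite -dconvA; apply: eq_dconv => // k.
by rewrite dconv_mangoldt_dconst1 lnn_dconst1.
Qed.

Lemma selbergE : selberg =1 dconv mu (lnn \* lnn).
Proof.
apply: moebius_inversion; last exact: dconv_selberg_dconst1.
by rewrite /selberg /mangoldt /dconv !big_nil mulr0 addr0.
Qed.

Lemma sum_selberg N : \sum_(1 <= n < N.+1) selberg n =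
  \sum_(1 <= d < N.+1) mu d * \sum_(1 <= m < (N %/ d).+1) lnn m ^+ 2.
Proof.
under eq_bigr do rewrite selbergE; rewrite sum_dconv; apply: eq_bigr => d _.
by congr (_ * _); apply: eq_bigr => m _; rewrite expr2.
Qed.

(** L kills the unit since ln 1 = 0. Applied to mu * 1 it yields (L mu) * 1 = - mu * L = - Lambda,
    which is then inverted. *)
Lemma lnn_mu : lnn \* mu =1 \- dconv mu mangoldt.
Proof.
have lnn_dunit : lnn \* dunit =1 (fun=> 0).
  by move=> [|[|k]] /=; rewrite /dunit ?mulr0// /lnn ln1 mul0r.
have mu_lnn : mangoldt =1 dconv mu lnn.
  apply: moebius_inversion; last exact: dconv_mangoldt_dconst1.
  by rewrite /mangoldt big_nil.
have H : dconv (lnn \* mu) dconst1 =1 \- mangoldt.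
  move=> n; have /= := dconv_derivation mu dconst1 (@lnnM R) n.
  rewrite dconv_mu_dconst1 [lnn n * _]lnn_dunit => /esym/eqP.
  rewrite addr_eq0 => /eqP ->; congr (- _).
  by rewrite mu_lnn; apply: eq_dconv => //; exact: lnn_dconst1.
move=> n; have -> := moebius_inversion _ H; last by rewrite /= lnn0 mul0r.
by rewrite /= dconvC dconvNl /= dconvC.
Qed.

Lemma lnn_lnn_mu n :
  lnn n ^+ 2 * mu n = dconv (dconv mangoldt mangoldt \+ \- (lnn \* mangoldt)) mu n.
Proof.
rewrite expr2 -mulrA [lnn n * mu n]lnn_mu mulrN.
have /= -> := dconv_derivation mu mangoldt (@lnnM R) n.
rewrite (eq_dconv lnn_mu (frefl mangoldt)) dconvNl/= dconvDl/= dconvNl/=.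
by rewrite opprD opprK -dconvA !(dconvC mu).
Qed.

Lemma sum_lnn_lnn_mu N : \sum_(1 <= n < N.+1) lnn n ^+ 2 * mu n =
  \sum_(1 <= n < N.+1) (dconv mangoldt mangoldt n - lnn n * mangoldt n) * mertens (N %/ n).
Proof. by under eq_bigr do rewrite lnn_lnn_mu; rewrite sum_dconv. Qed.

(** Both L Lambda and Lambda * Lambda are nonnegative, so the modulus of their difference is at most
    their sum [selberg]. *)
Lemma norm_sum_lnn_lnn_mu N : `|\sum_(1 <= n < N.+1) lnn n ^+ 2 * mu n| <=
  \sum_(1 <= n < N.+1) selberg n * `|mertens (N %/ n)|.
Proof.
rewrite sum_lnn_lnn_mu; apply: le_trans (ler_norm_sum _ _ _) _.
apply: ler_sum => n _; rewrite normrM ler_wpM2r//.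
have m2 : 0 <= dconv mangoldt mangoldt n.
  by apply: sumr_ge0 => a _; apply: sumr_ge0 => b _; rewrite mulr_ge0 ?mangoldt_ge0.
have m1 : 0 <= lnn n * mangoldt n by rewrite mulr_ge0 ?mangoldt_ge0 ?lnn_ge0.
by rewrite /selberg [leRHS]addrC (le_trans (ler_normB _ _))// !ger0_norm.
Qed.

(** Grouped by [k = d * n], the coefficient of [f k] is (mu * 1)(k), which vanishes unless
    [k = 1]. *)
Lemma sum_mu_dilate (f : nat -> R) N : (0 < N)%N ->
  \sum_(1 <= d < N.+1) mu d * \sum_(1 <= n < (N %/ d).+1) f (d * n)%N = f 1.
Proof.
move=> N0.
transitivity (\sum_(1 <= k < N.+1) dconv mu dconst1 k * f k); last first.
  under eq_bigr do rewrite dconv_mu_dconst1.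
  rewrite big_ltn// [X in _ + X]big_nat [X in _ + X]big1 ?addr0; last first.
    by move=> [|[|i]]//= _; rewrite mul0r.
  by rewrite /dunit mul1r.
transitivity (\sum_(1 <= k < N.+1) \sum_(1 <= d < N.+1) \sum_(1 <= n < N.+1)
   if (d * n == k)%N then mu d * f k else 0); last first.
  apply: eq_big_nat => k /andP[_ kN]; rewrite (@dconv_widen _ _ _ _ N)//.
  rewrite big_distrl; apply: eq_bigr => d _.
  rewrite big_distrl/= [RHS]big_mkcond/=.
  apply: eq_big_nat => n /andP[n0 _].
  by rewrite /dconst1 n0 mulr1.
rewrite exchange_big_nat/=; apply: eq_big_nat => d /andP[d0 _].
rewrite (@sum_nat_div _ N N)// big_distrr/= big_mkcond/= [RHS]exchange_big_nat/=.
apply: eq_big_nat => n /andP[n0 _].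
by rewrite -big_mkcond/= sum_nat_pick// muln_gt0 d0.
Qed.

End selberg_identities.

(** * Selberg's formula *)

Section real_estimates.
Context {R : realType}.
Implicit Types a b x y : R.

Lemma lnB_le a b : 0 < a -> 0 < b -> ln b - ln a <= (b - a) / a.
Proof.
move=> a0 b0; rewrite -ln_div ?posrE//.
have -> : b / a = 1 + (b - a) / a by field; rewrite gt_eqF.
apply: le_ln1Dx; rewrite mulrBl divff ?gt_eqF// ltrBrDr addNr divr_gt0//.
Qed.

Lemma lnB_ge a b : 0 < a -> 0 < b -> (b - a) / b <= ln b - ln a.
Proof.
move=> a0 b0; have := lnB_le b0 a0.
by rewrite -lerN2 -mulNr !opprB.
Qed.

Lemma ln_sqrt y : 0 < y -> ln y = 2 * ln (Num.sqrt y).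
Proof.
move=> y0; have s0 : 0 < Num.sqrt y by rewrite sqrtr_gt0.
by rewrite -{1}(sqr_sqrtr (ltW y0)) lnXn// [RHS]mulr_natl.
Qed.

Lemma ln_le_sqrt y : 0 < y -> ln y <= 2 * Num.sqrt y.
Proof.
move=> y0; have s0 : 0 < Num.sqrt y by rewrite sqrtr_gt0.
rewrite ln_sqrt// ler_pM2l//.
have := lnB_le ltr01 s0; rewrite ln1 subr0 divr1 => /le_trans; apply.
by rewrite gerBl.
Qed.

Lemma sqr_ln_le_sqrt y : 1 <= y -> ln y ^+ 2 <= 16 * Num.sqrt y.
Proof.
move=> y1; have y0 : 0 < y := lt_le_trans ltr01 y1.
have s0 : 0 < Num.sqrt y by rewrite sqrtr_gt0.
(* Halving the exponent twice gives [ln y <= 4 * y ^ (1/4)]; the constant 16 is the square of 4. *)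
have l4 : ln y <= 4 * Num.sqrt (Num.sqrt y) by rewrite ln_sqrt//; have := ln_le_sqrt s0; lra.
have := sqr_sqrtr (ltW s0) => <-.
rewrite (_ : 16 * _ = (4 * Num.sqrt (Num.sqrt y)) ^+ 2); last by ring.
by rewrite ler_sqr ?nnegrE ?ln_ge0// mulr_ge0// sqrtr_ge0.
Qed.

(* a - b is nondecreasing and a + b nonincreasing; the limit is sup (a - b). *)
Lemma telescoping_limit (a b : nat -> R) :
  (forall k, 0 <= b k) -> (forall k, `|a k.+1 - a k| <= b k - b k.+1) ->
  exists c, forall k, `|a k - c| <= b k.
Proof.
move=> b0 ab.
have lo m k : (m <= k)%N -> a m - b m <= a k - b k.
  move/subnK => <-; elim: (k - m)%N => // j IH; rewrite (le_trans IH)// addSn.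
  by have := ab (j + m)%N; rewrite ler_norml => /andP[+ _]; lra.
have up m k : (m <= k)%N -> a k + b k <= a m + b m.
  move/subnK => <-; elim: (k - m)%N => // j IH; rewrite (le_trans _ IH)// addSn.
  by have := ab (j + m)%N; rewrite ler_norml => /andP[_ +]; lra.
(* The two monotone sequences are compared at the common index [maxn m k], where [b] is
   nonnegative. *)
have cross m k : a m - b m <= a k + b k.
  rewrite (le_trans (lo _ _ (leq_maxl m k)))//.
  rewrite (le_trans _ (up _ _ (leq_maxr m k)))//.
  by have := b0 (maxn m k); lra.
pose E := [set x | exists k, x = a k - b k]%classic.
have ubE k : (ubound E) (a k + b k) by move=> _ [m ->]; exact: cross.
exists (sup E) => k; rewrite ler_distlC; apply/andP; split.
  by apply: ub_le_sup; [exists (a 0 + b 0); exact: ubE|exists k].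
by apply: ge_sup => //; exists (a 0 - b 0), 0.
Qed.

(* a primitive of ln ^ 2 *)
Definition lnsq_prim y : R := y * ln y ^+ 2 - 2 * (y * ln y) + 2 * y.

(** By the mean value theorem the increment is [(b - a) * ln c ^+ 2] for some [c] in between, and
    the squared logarithm is nondecreasing from 1 on. *)
Lemma lnsq_primB a b : 1 <= a -> a <= b ->
  (b - a) * ln a ^+ 2 <= lnsq_prim b - lnsq_prim a <= (b - a) * ln b ^+ 2.
Proof.
move=> a1 ab; have a0 : 0 < a := lt_le_trans ltr01 a1.
have D (x : R) : 0 < x -> is_derive x 1 lnsq_prim (ln x ^+ 2).
  move=> x0; have Dln := is_derive1_ln x0.
  rewrite /lnsq_prim; apply: is_derive_eq.
  rewrite !/GRing.scale/=. field. by rewrite gt_eqF.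
have [x||c] := @MVT_segment R lnsq_prim (fun x => ln x ^+ 2) a b ab.
- by rewrite in_itv/= => /andP[ax _]; apply: D; exact: lt_trans ax.
- apply: derivable_within_continuous => x; rewrite in_itv/= => /andP[ax _].
  by apply: (@ex_derive _ _ _ _ _ _ _ (D x _)); exact: lt_le_trans ax.
rewrite in_itv/= => /andP[ac cb] ->.
have c0 : 0 < c := lt_le_trans a0 ac.
rewrite !(mulrC (b - a)) !ler_wpM2r ?subr_ge0//;
  by rewrite ler_sqr ?nnegrE ?ln_ge0 ?(le_trans a1)// ler_ln// posrE (lt_le_trans c0).
Qed.

End real_estimates.

(** * Asymptotic expansions and the summatory function of [selberg] *)

Section selberg_formula.
Context {R : realType}.
Local Notation mu := (@mu R).
Local Notation lnn := (@lnn R).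
Local Notation mangoldt := (@mangoldt R).
Local Notation selberg := (@selberg R).
Implicit Types (k N : nat) (y : R).

Lemma lnnS_le k : (0 < k)%N -> lnn k.+1 - lnn k <= k%:R^-1.
Proof.
move=> k0; rewrite /lnn; have := @lnB_le R k%:R k.+1%:R.
rewrite !ltr0n => /(_ k0 isT) /le_trans; apply.
by rewrite -natrB ?leqnSn// subSnn div1r.
Qed.

Lemma lnnS_ge k : (0 < k)%N -> k.+1%:R^-1 <= lnn k.+1 - lnn k.
Proof.
move=> k0; rewrite /lnn; have := @lnB_ge R k%:R k.+1%:R.
rewrite !ltr0n => /(_ k0 isT); apply: le_trans.
by rewrite -natrB ?leqnSn// subSnn div1r.
Qed.

(** Later [y] is [N / d] and [k] its integer part; these bounds transfer estimates from [k] to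
    [y]. *)
Lemma ln_natr_bounds k y : (0 < k)%N -> k%:R <= y -> y <= k.+1%:R ->
  [/\ 1 <= y, 0 <= lnn k, lnn k <= ln y, (ln y - lnn k) * k%:R <= 1 & y <= 2 * k%:R].
Proof.
move=> k0 ky yk; have k1 : 1 <= k%:R :> R by rewrite ler1n.
have k0' : 0 < k%:R :> R by rewrite ltr0n.
have y0 : 0 < y := lt_le_trans k0' ky.
split; [exact: le_trans ky|exact: lnn_ge0| | |].
- by rewrite ler_ln// posrE.
- have := lnB_le k0' y0; rewrite ler_pdivlMr// => /le_trans; apply.
  by move: yk; rewrite -natr1; lra.
- by move: yk; rewrite -natr1; lra.
Qed.

(** The constant is Euler's. The telescoping error at [k] and the replacement of [ln k] by [ln y]
    cost [1 / k] each, and [y <= 2 * k] turns [2 / k] into 4. *)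
Lemma harmonic_asymp : exists g : R, forall k y, (0 < k)%N -> k%:R <= y -> y <= k.+1%:R ->
  y * `|\sum_(1 <= n < k.+1) n%:R^-1 - ln y - g| <= 4.
Proof.
pose a j := \sum_(1 <= n < j.+2) n%:R^-1 - lnn j.+1.
have [j|j|g Hg] := @telescoping_limit R a (fun j => j.+1%:R^-1).
- by rewrite invr_ge0.
- have -> : a j.+1 - a j = j.+2%:R^-1 - (lnn j.+2 - lnn j.+1).
    rewrite /a (@big_nat_recr _ _ _ j.+2)//=; ring.
  have := @lnnS_le j.+1 isT; have := @lnnS_ge j.+1 isT.
  move: (lnn j.+2 - lnn j.+1) (j.+1%:R^-1) (j.+2%:R^-1) => u p q.
  by rewrite ler_norml => *; apply/andP; split; lra.
exists g => -[//|k] y _ ky yk.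
have [y1 lk lky lyk y2k] := ln_natr_bounds (ltn0Sn k) ky yk.
have k0 : 0 < k.+1%:R :> R by rewrite ltr0n.
have Hk : `|\sum_(1 <= n < k.+2) n%:R^-1 - ln y - g| <= 2 * k.+1%:R^-1.
  have -> : \sum_(1 <= n < k.+2) n%:R^-1 - ln y - g = (a k - g) - (ln y - lnn k.+1).
    by rewrite /a; ring.
  rewrite (le_trans (ler_normB _ _))// (_ : 2 * _ = k.+1%:R^-1 + k.+1%:R^-1); last by ring.
  rewrite lerD ?Hg// ger0_norm ?subr_ge0//.
  by rewrite -[leRHS]mul1r ler_pdivlMr.
rewrite (le_trans (ler_wpM2l _ Hk)) ?(le_trans ler01)//.
by rewrite mulrA ler_pdivrMr//; lra.
Qed.

Lemma log_harmonic_asymp : exists c : R, forall k y, (0 < k)%N -> k%:R <= y -> y <= k.+1%:R ->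
  y * `|\sum_(1 <= n < k.+1) lnn n / n%:R - ln y ^+ 2 / 2 - c| <= 4 * (1 + ln y).
Proof.
pose a j := \sum_(1 <= n < j.+2) lnn n / n%:R - lnn j.+1 ^+ 2 / 2.
have [j|j|c Hc] := @telescoping_limit R a (fun j => (lnn j.+1 + 2) / j.+1%:R).
- by rewrite divr_ge0// addr_ge0// lnn_ge0.
- have k0 : 0 < j.+1%:R :> R by rewrite ltr0n.
  have := @lnnS_le j.+1 isT; have := @lnnS_ge j.+1 isT.
  have l0 := lnn_ge0 (R := R) j.+1.
  have -> : a j.+1 - a j = lnn j.+2 / j.+2%:R - lnn j.+2 ^+ 2 / 2 + lnn j.+1 ^+ 2 / 2.
    rewrite /a (@big_nat_recr _ _ _ j.+2)//=; ring.
  set u := lnn j.+2 - lnn j.+1; have -> : lnn j.+2 = lnn j.+1 + u by rewrite /u; ring.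
  rewrite -(natr1 j.+1); move: (lnn j.+1) l0 u k0 => l l0 u.
  set k : R := j.+1%:R => k0 ul uh.
  (* The increment of [a] is [- l * (u - q) + u * q - u ^+ 2 / 2], with [u] between [q] and [p]. The
     decrement of the majorant is [l * (p - q) + 2 * p * q - u * q]: the terms in [l] compare
     directly, and the 2 in the majorant pays for the rest. *)
  set p := k^-1 in uh *; set q := (k + 1)^-1 in ul *.
  have pq : p - q = p * q by rewrite /p /q; field; rewrite !gt_eqF//; lra.
  have q0 : 0 < q by rewrite invr_gt0; lra.
  have p0 : 0 < p by rewrite invr_gt0.
  have u0 : 0 <= u by lra.
  have p1 : p <= 1 by rewrite invf_le1// /k ler1n.
  have lu1 : 0 <= l * (u - q) by rewrite mulr_ge0// subr_ge0.
  have lu2 : 0 <= l * (p - u) by rewrite mulr_ge0// subr_ge0.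
  have u2 : u ^+ 2 <= p ^+ 2 by rewrite ler_sqr ?nnegrE// ltW.
  have uq : u * q <= p * q by rewrite ler_wpM2r// ltW.
  have p2 : p ^+ 2 <= 2 * (p * q).
    rewrite expr2; have -> : p * p = p * (q + p * q) by congr (_ * _); lra.
    by rewrite mulrDr mulrA; have : p * (p * q) <= 1 * (p * q); [rewrite ler_wpM2r// mulr_ge0// ltW|]; lra.
  by rewrite ler_norml; apply/andP; split; nra.
exists c => -[//|k] y _ ky yk.
have [y1 lk lky lyk y2k] := ln_natr_bounds (ltn0Sn k) ky yk.
have k0 : 0 < k.+1%:R :> R by rewrite ltr0n.
have Hk : `|\sum_(1 <= n < k.+2) lnn n / n%:R - ln y ^+ 2 / 2 - c| <=
    (2 * (1 + ln y)) * k.+1%:R^-1.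
  have -> : \sum_(1 <= n < k.+2) lnn n / n%:R - ln y ^+ 2 / 2 - c =
     (a k - c) - (ln y ^+ 2 - lnn k.+1 ^+ 2) / 2.
    by rewrite /a; ring.
  rewrite (le_trans (ler_normB _ _))// (_ : 2 * _ * _ =
     (ln y + 2) / k.+1%:R + ln y / k.+1%:R); last by ring.
  rewrite lerD//.
    by rewrite (le_trans (Hc _))// ler_wpM2r ?invr_ge0// lerD2r.
  rewrite ger0_norm; last by rewrite divr_ge0// subr_ge0 ler_sqr// nnegrE// (le_trans lk).
  rewrite ler_pdivlMr//; nra.
rewrite (le_trans (ler_wpM2l _ Hk)) ?(le_trans ler01)//.
rewrite mulrA ler_pdivrMr//; nra.
Qed.

(** Comparison of sum and integral: each step changes the difference by at most an increment of the
    squared logarithm, which telescopes. The 2 is [lnsq_prim 1]. *)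
Lemma sum_lnsq_asymp k y : (0 < k)%N -> k%:R <= y -> y <= k.+1%:R ->
  `|\sum_(1 <= n < k.+1) lnn n ^+ 2 - lnsq_prim y| <= 2 + ln y ^+ 2.
Proof.
case: k => // k _ ky yk.
have [y1 lk lky lyk y2k] := ln_natr_bounds (ltn0Sn k) ky yk.
have step j : 0 <= lnn j.+2 ^+ 2 - (lnsq_prim j.+2%:R - lnsq_prim j.+1%:R)
              <= lnn j.+2 ^+ 2 - lnn j.+1 ^+ 2.
  have := @lnsq_primB R j.+1%:R j.+2%:R.
  rewrite ler1n ler_nat leqnSn => /(_ isT isT).
  by rewrite -natrB// subSnn !mul1r /lnn => /andP[? ?]; apply/andP; split; lra.
have : -2 <= \sum_(1 <= n < k.+2) lnn n ^+ 2 - lnsq_prim k.+1%:R <= lnn k.+1 ^+ 2 - 2.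
  elim: k {ky yk lk lky lyk y2k} => [|k /andP[IH1 IH2]].
    by rewrite big_nat1 /lnsq_prim /lnn ln1; apply/andP; split; lra.
  rewrite (@big_nat_recr _ _ _ k.+2)//=; have /andP[? ?] := step k.
  by apply/andP; split; lra.
have k1 : 1 <= k.+1%:R :> R by rewrite ler1n.
have /andP[? ?] := lnsq_primB k1 ky.
have h1 : 0 <= (y - k.+1%:R) * ln k.+1%:R ^+ 2 by rewrite mulr_ge0 ?sqr_ge0// subr_ge0.
have h2 : (y - k.+1%:R) * ln y ^+ 2 <= ln y ^+ 2.
  by rewrite ler_piMl ?sqr_ge0//; move: yk; rewrite -[k.+2%:R]natr1; lra.
have h3 : lnn k.+1 ^+ 2 <= ln y ^+ 2 by rewrite ler_sqr// nnegrE// (le_trans lk).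
by move=> /andP[? ?]; rewrite ler_norml; apply/andP; split; lra.
Qed.

(** Since [1 / sqrt d <= 2 * (sqrt d - sqrt (d - 1))], the sum telescopes. Errors of size
    [sqrt (N / d)] thus add up to O(N), with no logarithm. *)
Lemma sum_sqrt_div N : \sum_(1 <= d < N.+1) Num.sqrt (N%:R / d%:R) <= 2 * N%:R :> R.
Proof.
have [->|N0] := posnP N; first by rewrite big_nil mulr0.
have H n : \sum_(1 <= d < n.+1) (Num.sqrt d%:R)^-1 <= 2 * Num.sqrt n%:R :> R.
  elim: n => [|n IH]; first by rewrite big_nil mulr_ge0// sqrtr_ge0.
  rewrite big_nat_recr//= (le_trans (lerD IH (lexx _)))//.
  set s := Num.sqrt n%:R; set t := Num.sqrt n.+1%:R.
  have s0 : 0 <= s by rewrite sqrtr_ge0.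
  have t0 : 0 < t by rewrite sqrtr_gt0 ltr0n.
  have st : s <= t by rewrite ler_sqrt ?ler_nat.
  have E : t ^+ 2 = s ^+ 2 + 1 by rewrite !sqr_sqrtr// natr1.
  rewrite -lerBrDl -[_^-1]mul1r ler_pdivrMr//; nra.
rewrite (eq_bigr (fun d => Num.sqrt N%:R * (Num.sqrt d%:R)^-1)); last first.
  by move=> d _; rewrite sqrtrM// sqrtrV.
rewrite -big_distrr/= (le_trans (ler_wpM2l _ (H N))) ?sqrtr_ge0//.
by rewrite mulrCA -expr2 sqr_sqrtr.
Qed.

Lemma divn_natr_bounds N d : (0 < d)%N -> (d <= N)%N ->
  [/\ (0 < N %/ d)%N, (N %/ d)%:R <= N%:R / d%:R :> R & N%:R / d%:R <= (N %/ d).+1%:R :> R].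
Proof.
move=> d0 dN; have d0' : 0 < d%:R :> R by rewrite ltr0n.
split; first by rewrite divn_gt0.
  by rewrite ler_pdivlMr// -natrM ler_nat leq_trunc_div.
by rewrite ler_pdivrMr// -natrM ler_nat ltnW// ltn_ceil.
Qed.

(* g and C are chosen so that all terms of order larger than sqrt y cancel;
   summed against mu d with y = N / d, the three correction terms are explicit
   by sum_mu_dilate and the error is O(N). *)
Lemma selberg_kernel_bound : exists g C B : R, 0 <= B /\
  forall k y, (0 < k)%N -> k%:R <= y -> y <= k.+1%:R ->
  `|\sum_(1 <= n < k.+1) lnn n ^+ 2
    - 2 * (y * \sum_(1 <= n < k.+1) (ln y - lnn n) / n%:R)
    + g * (y * \sum_(1 <= n < k.+1) n%:R^-1) + C * k%:R| <= B * Num.sqrt y.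
Proof.
have [g Hg] := harmonic_asymp; have [c Hc] := log_harmonic_asymp.
(* Before correction [y * ln y] has coefficient [- 2 - 2 * g], which fixes [G]; the remaining
   [(2 + 2 * c + G * g) * y] fixes [C]. *)
pose G := 2 + 2 * g; pose C := - (2 + 2 * c + G * g).
exists G, C, (100 + 4 * `|G| + `|C|); split; first by rewrite !addr_ge0// mulr_ge0.
move=> k y k0 ky yk.
have [y1 lk lky lyk y2k] := ln_natr_bounds k0 ky yk.
have -> : \sum_(1 <= n < k.+1) (ln y - lnn n) / n%:R =
   ln y * \sum_(1 <= n < k.+1) n%:R^-1 - \sum_(1 <= n < k.+1) lnn n / n%:R.
  by rewrite big_distrr -sumrB/=; apply: eq_bigr => n _; rewrite mulrBl.
set S := \sum_(1 <= n < k.+1) _; set H := \sum_(1 <= n < k.+1) _; set T := \sum_(1 <= n < k.+1) _.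
have sy : 1 <= Num.sqrt y by rewrite -[leLHS]sqrtr1 ler_sqrt ?(le_trans ler01).
have l1 : ln y <= 2 * Num.sqrt y by rewrite ln_le_sqrt ?(lt_le_trans ltr01).
have l2 := sqr_ln_le_sqrt y1.
have y0 : 0 <= y := le_trans ler01 y1.
have l0 : 0 <= ln y by rewrite ln_ge0.
have h1 : `|S - lnsq_prim y| <= 2 + ln y ^+ 2 := sum_lnsq_asymp k0 ky yk.
have h2 : `|y * (T - ln y ^+ 2 / 2 - c)| <= 4 * (1 + ln y).
  by rewrite normrM (ger0_norm y0); exact: Hc.
have h3 : `|y * (H - ln y - g)| <= 4.
  by rewrite normrM (ger0_norm y0); exact: Hg.
have h4 : `|C * (y - k%:R)| <= `|C|.
  by rewrite normrM ler_piMr// ler_norml; move: ky yk; rewrite -natr1 => *; apply/andP; split; lra.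
set e3 := S - lnsq_prim y in h1.
have -> : S - 2 * (y * (ln y * H - T)) + G * (y * H) + C * k%:R =
  e3 + (- (2 * ln y) * (y * (H - ln y - g))) + 2 * (y * (T - ln y ^+ 2 / 2 - c))
   + G * (y * (H - ln y - g)) - C * (y - k%:R).
  by rewrite /e3 /C /G /lnsq_prim; field.
set e1 := y * (H - ln y - g) in h3 *; set e2 := y * (T - ln y ^+ 2 / 2 - c) in h2 *.
set e4 := C * (y - k%:R) in h4 *.
have h5 : `|- (2 * ln y) * e1| <= 8 * ln y.
  have l20 : 0 <= 2 * ln y by rewrite mulr_ge0.
  rewrite normrM normrN (ger0_norm l20) (_ : 8 * _ = 2 * ln y * 4); last by ring.
  by rewrite ler_wpM2l.
have h6 : `|G * e1| <= 4 * `|G| by rewrite normrM mulrC ler_wpM2r.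
have h7 : `|2 * e2| <= 8 * (1 + ln y) by rewrite normrM ger0_norm//; lra.
rewrite (le_trans (ler_normB _ _))// (le_trans (lerD (ler_normD _ _) h4))//.
rewrite (le_trans (lerD (lerD (ler_normD _ _) h6) (lexx _)))//.
rewrite (le_trans (lerD (lerD (lerD (ler_normD _ _) h7) (lexx _)) (lexx _)))//.
rewrite (le_trans (lerD (lerD (lerD (lerD h1 h5) (lexx _)) (lexx _)) (lexx _)))//.
have hG : 0 <= `|G| * (Num.sqrt y - 1) by rewrite mulr_ge0// subr_ge0.
have hC : 0 <= `|C| * (Num.sqrt y - 1) by rewrite mulr_ge0// subr_ge0.
move: l1 l2 hG hC sy.
move: (ln y ^+ 2) (ln y) (Num.sqrt y) `|G| `|C| => l2 l s aG aC; clear; lra.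
Qed.

Lemma selberg_formula_lnn : exists B : R, forall N, (0 < N)%N ->
  `|\sum_(1 <= n < N.+1) selberg n - 2 * (N%:R * lnn N)| <= B * N%:R.
Proof.
have [g [C [B [B0 HB]]]] := selberg_kernel_bound.
exists (B * 2 + `|g| + `|C|) => N N0.
have NR0 : 0 < N%:R :> R by rewrite ltr0n.
have N1 : 1 <= N%:R :> R by rewrite ler1n.
have E1 : \sum_(1 <= d < N.+1) mu d * (N%:R / d%:R *
    \sum_(1 <= n < (N %/ d).+1) (ln (N%:R / d%:R) - lnn n) / n%:R) = N%:R * lnn N.
  (* The value of this function at 1 is [N * ln N], the source of the main term. *)
  have := sum_mu_dilate (fun k => (lnn N - lnn k) * (N%:R / k%:R)) N0.
  rewrite divr1 (_ : lnn 1 = 0) ?subr0; last by rewrite /lnn ln1.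
  rewrite mulrC => <-; apply: eq_big_nat => d /andP[d0 _]; congr (_ * _).
  rewrite big_distrr/=; apply: eq_big_nat => n /andP[n0 _].
  rewrite lnnM// ln_div ?posrE ?ltr0n// natrM /lnn.
  by field; rewrite !pnatr_eq0 -!lt0n d0 n0.
have E2 : \sum_(1 <= d < N.+1) mu d * (N%:R / d%:R *
    \sum_(1 <= n < (N %/ d).+1) n%:R^-1) = N%:R.
  have := sum_mu_dilate (fun k => (N%:R / k%:R) : R) N0.
  rewrite divr1 => E; rewrite -[RHS]E; apply: eq_big_nat => d /andP[d0 _]; congr (_ * _).
  rewrite big_distrr/=; apply: eq_big_nat => n /andP[n0 _].
  by rewrite natrM invfM mulrA.
have E3 : \sum_(1 <= d < N.+1) mu d * (N %/ d)%:R = 1.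
  rewrite -[RHS](sum_mu_dilate (fun=> 1 : R) N0); apply: eq_bigr => d _.
  by rewrite sumr_const_nat subn1.
rewrite sum_selberg.
have sum_split (u v w z : nat -> R) :
    \sum_(1 <= d < N.+1) mu d * (u d - 2 * v d + g * w d + C * z d) =
    \sum_(1 <= d < N.+1) mu d * u d - 2 * \sum_(1 <= d < N.+1) mu d * v d +
    g * \sum_(1 <= d < N.+1) mu d * w d + C * \sum_(1 <= d < N.+1) mu d * z d.
  rewrite !big_distrr/= -sumrB -!big_split/=; apply: eq_bigr => d _; ring.
have := sum_split (fun d => \sum_(1 <= n < (N %/ d).+1) lnn n ^+ 2)
  (fun d => N%:R / d%:R * \sum_(1 <= n < (N %/ d).+1) (ln (N%:R / d%:R) - lnn n) / n%:R)
  (fun d => N%:R / d%:R * \sum_(1 <= n < (N %/ d).+1) n%:R^-1)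
  (fun d => (N %/ d)%:R).
rewrite /= E1 E2 E3 mulr1 => E.
(* [E] evaluates the kernel sum as the difference to be bounded plus [g * N + C]; the last two terms
   are O(N) and go into the error. *)
rewrite -[X in `|X|](addrK (g * N%:R + C)) addrA -E opprD addrA.
rewrite (le_trans (ler_normB _ _))// (le_trans (lerD (ler_normB _ _) (lexx _)))//.
rewrite !mulrDl; apply: lerD; last by rewrite ler_peMr.
apply: lerD; last by rewrite normrM (ger0_norm (ltW NR0)).
rewrite (le_trans (ler_norm_sum _ _ _))//.
rewrite -mulrA (le_trans _ (ler_wpM2l B0 (sum_sqrt_div N)))// big_distrr/=.
rewrite big_nat [leRHS]big_nat; apply: ler_sum => d /andP[d0 dN].
have [k0 ky yk] := divn_natr_bounds d0 dN.
rewrite normrM (le_trans (ler_piMl _ (norm_mu_le1 _)))//.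
exact: HB.
Qed.

Lemma sum_lnn_bounds N :
  N%:R * lnn N - N%:R <= \sum_(1 <= n < N.+1) lnn n <= N%:R * lnn N.
Proof.
elim: N => [|[|N] /andP[IH1 IH2]]; first by rewrite big_nil !mul0r subr0 lexx.
  by rewrite big_nat1 /lnn ln1 mulr0 lexx sub0r lerN10.
rewrite big_nat_recr//=.
have := @lnnS_le N.+1 isT; have := @lnnS_ge N.+1 isT.
move: (lnn N.+2) (lnn N.+1) IH1 IH2 => m l; rewrite -[N.+2%:R]natr1.
have : 0 < N.+1%:R :> R by rewrite ltr0n.
move: (N.+1%:R) (\sum_(1 <= n < N.+2) lnn n) => x s x0 IH1 IH2.
rewrite -[_^-1]mul1r ler_pdivrMr ?addr_gt0// => h1.
rewrite -[_^-1]mul1r ler_pdivlMr// => h2.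
by apply/andP; split; nra.
Qed.

(** The main term becomes the summatory function of [2 * lnn], the form suited to summation by
    parts; this costs at most [2 * N]. *)
Lemma selberg_formula : exists B : R, 0 <= B /\ forall N,
  `|\sum_(1 <= n < N.+1) (selberg n - 2 * lnn n)| <= B * N%:R.
Proof.
have [B HB] := selberg_formula_lnn; exists (`|B| + 2); split; first by rewrite addr_ge0.
move=> [|N]; first by rewrite big_nil normr0 mulr0.
rewrite sumrB -big_distrr/=.
have := HB N.+1 isT; have /andP[] := sum_lnn_bounds N.+1.
have : B * N.+1%:R <= `|B| * N.+1%:R by rewrite ler_wpM2r// ler_norm.
move: (\sum_(1 <= n < N.+2) selberg n) (\sum_(1 <= n < N.+2) lnn n) => s t h1 h2 h3.
rewrite !ler_norml => /andP[h4 h5]; rewrite mulrDl; apply/andP; split; lra.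
Qed.

End selberg_formula.

(** * Selberg's inequality for the Mertens function *)

Section mertens_inequality.
Context {R : realType}.
Local Notation mu := (@mu R).
Local Notation lnn := (@lnn R).
Local Notation selberg := (@selberg R).
Local Notation mertens := (@mertens R).
Implicit Types (k N : nat).

Lemma mertens_lip m k : (m <= k)%N -> `|mertens k - mertens m| <= k%:R - m%:R.
Proof.
move=> mk; rewrite /mertens (big_cat_nat (n := m.+1))//= addrAC subrr add0r.
rewrite (le_trans (ler_norm_sum _ _ _))//.
rewrite (le_trans (ler_sum _ (fun i _ => norm_mu_le1 i)))//.
by rewrite sumr_const_nat subSS natrB.
Qed.

Lemma mertens0 : mertens 0 = 0.
Proof. by rewrite /mertens big_nil. Qed.

Lemma norm_mertens_le k : `|mertens k| <= k%:R.
Proof. by have := mertens_lip (leq0n k); rewrite mertens0 !subr0. Qed.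

(** The boundary weight sits at [N.+1], so it disappears for weights built from [N %/ n] that vanish
    with it. *)
Lemma abel_summation (s w : nat -> R) N :
  \sum_(1 <= n < N.+1) s n * w n =
  (\sum_(1 <= n < N.+1) s n) * w N.+1 +
  \sum_(1 <= n < N.+1) (\sum_(1 <= i < n.+1) s i) * (w n - w n.+1).
Proof.
elim: N => [|N IH]; first by rewrite !big_nil mul0r addr0.
rewrite big_nat_recr//= IH [in RHS]big_nat_recr//=.
rewrite [X in _ = _ + X]big_nat_recr//= [in X in _ = _ + (_ + X)]big_nat_recr//=; ring.
Qed.

Lemma harmonic_le N : \sum_(1 <= n < N.+1) n%:R^-1 <= 1 + lnn N.
Proof.
elim: N => [|[|N] IH]; first by rewrite big_nil lnn0 addr0.
  by rewrite big_nat1 invr1 lerDl lnn_ge0.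
rewrite big_nat_recr//=; have := @lnnS_ge R N.+1 isT.
move: (N.+2%:R^-1) => x; lra.
Qed.

Lemma divn_natr_le N n : (N %/ n)%:R <= N%:R / n%:R :> R.
Proof.
case: n => [|n]; first by rewrite divn0 mulr_ge0.
by rewrite ler_pdivlMr ?ltr0n// -natrM ler_nat leq_trunc_div.
Qed.

Lemma sum_divn_le N : \sum_(1 <= n < N.+1) (N %/ n)%:R <= N%:R * (1 + lnn N).
Proof.
rewrite (le_trans (ler_sum _ (fun n _ => divn_natr_le N n)))//.
by rewrite -big_distrr/= ler_wpM2l// harmonic_le.
Qed.

(** The partial sums are O(n), and by the Lipschitz bound the weights vary by at most the decrease
    of [N %/ n]. A second summation by parts, with constant sequence 1, turns the resulting sum back
    into the sum of [N %/ n]. *)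
Lemma norm_sum_selberg_mertens : exists B : R, 0 <= B /\ forall N,
  `|\sum_(1 <= n < N.+1) (selberg n - 2 * lnn n) * `|mertens (N %/ n)| |
    <= B * (N%:R * (1 + lnn N)).
Proof.
have [B [B0 HB]] := @selberg_formula R; exists B; split => // N.
rewrite abel_summation divn_small// mertens0 normr0 mulr0 add0r.
rewrite (le_trans (ler_norm_sum _ _ _))//.
pose q n : R := (N %/ n)%:R.
have : \sum_(1 <= n < N.+1) n%:R * (q n - q n.+1) <= N%:R * (1 + lnn N).
  have := abel_summation (fun=> 1) q N.
  rewrite [q N.+1]/q divn_small// mulr0 add0r.
  under eq_bigr do rewrite mul1r.
  under [in X in _ = X -> _]eq_bigr do rewrite sumr_const_nat subn1/=.
  by move=> <-; exact: sum_divn_le.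
move=> /(ler_wpM2l B0); apply: le_trans; rewrite big_distrr/=.
rewrite big_nat [leRHS]big_nat; apply: ler_sum => n /andP[n0 nN].
rewrite normrM mulrA ler_pM//.
rewrite (le_trans (ler_dist_dist _ _))// mertens_lip//.
exact: leq_div2l.
Qed.

(** Here [ln N ^ 2 - ln n ^ 2 <= 2 * ln N * (ln N - ln n)], and the sum of [ln N - ln n] is at most
    [N]. *)
Lemma mertens_lnnsq N : (0 < N)%N ->
  `|mertens N| * lnn N ^+ 2 <=
    `|\sum_(1 <= n < N.+1) lnn n ^+ 2 * mu n| + 2 * (N%:R * lnn N).
Proof.
move=> N0; set S := \sum_(_ <= _ < _) _.
have -> : `|mertens N| * lnn N ^+ 2 = `|S + \sum_(1 <= n < N.+1) (lnn N ^+ 2 - lnn n ^+ 2) * mu n|.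
  rewrite -[X in _ * X]ger0_norm ?sqr_ge0// -normrM /S -big_split/= mulrC big_distrr/=.
  by congr (`|_|); apply: eq_bigr => n _; ring.
rewrite (le_trans (ler_normD _ _))// lerD2l (le_trans (ler_norm_sum _ _ _))//.
have l0 := lnn_ge0 (R := R).
have : \sum_(1 <= n < N.+1) `|(lnn N ^+ 2 - lnn n ^+ 2) * mu n| <=
    \sum_(1 <= n < N.+1) 2 * lnn N * (lnn N - lnn n).
  rewrite big_nat [leRHS]big_nat; apply: ler_sum => n /andP[n0 nN].
  have ln : lnn n <= lnn N by exact: ler_lnn.
  have := l0 n; have := l0 N => ? ?.
  have h : 0 <= lnn N ^+ 2 - lnn n ^+ 2 by rewrite subr_ge0 ler_sqr// nnegrE.
  rewrite normrM (ger0_norm h) (le_trans (ler_piMr _ (norm_mu_le1 _)))//; nra.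
move=> /le_trans; apply; rewrite -big_distrr/= sumrB.
rewrite -mulrA ler_pM2l// mulrC ler_wpM2r//.
rewrite sumr_const_nat subn1/= -[_ *+ N]mulr_natl.
by have /andP[? ?] := @sum_lnn_bounds R N; lra.
Qed.

Lemma mertens_selberg_inequality : exists B : R, 0 <= B /\ forall N, (0 < N)%N ->
  `|mertens N| * lnn N ^+ 2 <=
    2 * \sum_(1 <= n < N.+1) lnn n * `|mertens (N %/ n)| + B * (N%:R * (1 + lnn N)).
Proof.
have [B [B0 HB]] := norm_sum_selberg_mertens; exists (B + 2); split; first by rewrite addr_ge0.
move=> N N0; rewrite (le_trans (mertens_lnnsq N0))//.
rewrite (le_trans (lerD (norm_sum_lnn_lnn_mu _) (lexx _)))//.
have -> : \sum_(1 <= n < N.+1) selberg n * `|mertens (N %/ n)| =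
  2 * (\sum_(1 <= n < N.+1) lnn n * `|mertens (N %/ n)|) +
  \sum_(1 <= n < N.+1) (selberg n - 2 * lnn n) * `|mertens (N %/ n)|.
  by rewrite big_distrr -big_split/=; apply: eq_bigr => n _; ring.
have := HB N; rewrite ler_norml => /andP[_ h].
have : 0 <= N%:R :> R by [].
rewrite mulrDl; lra.
Qed.

End mertens_inequality.

(** * Sign changes and the Tauberian argument *)

Section sign_changes.
Context {R : realType}.
Local Notation mu := (@mu R).
Local Notation lnn := (@lnn R).
Local Notation mertens := (@mertens R).
Implicit Types (k N : nat).

Lemma sum_mu_divn k : (0 < k)%N -> \sum_(1 <= j < k.+1) mu j * (k %/ j)%:R = 1.
Proof.
move=> k0; rewrite -[RHS](sum_mu_dilate (fun=> 1 : R) k0); apply: eq_bigr => d _.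
by rewrite sumr_const_nat subn1.
Qed.

Lemma divn_natr_dist N n : (0 < n)%N -> `|N%:R / n%:R - (N %/ n)%:R| <= 1 :> R.
Proof.
move=> n0; have n0' : 0 < n%:R :> R by rewrite ltr0n.
rewrite ger0_norm ?subr_ge0 ?divn_natr_le// lerBlDl natr1.
by rewrite ler_pdivrMr// -natrM ler_nat ltnW// ltn_ceil.
Qed.

Lemma norm_sum_mu_divn_sub N k :
  `|\sum_(1 <= j < k.+1) mu j * (N%:R / j%:R - (N %/ j)%:R)| <= k%:R.
Proof.
rewrite (le_trans (ler_norm_sum _ _ _))//.
rewrite (@le_trans _ _ (\sum_(1 <= j < k.+1) 1))//; last by rewrite sumr_const_nat subn1.
rewrite big_nat [leRHS]big_nat; apply: ler_sum => j /andP[j0 _].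
by rewrite normrM -[leRHS]mulr1 ler_pM// ?norm_mu_le1 ?divn_natr_dist.
Qed.

(** Replacing [k / j] by its integer part costs at most [k] in all, and the sum with integer parts
    is 1; then divide by [k]. *)
Lemma norm_sum_mu_div_le2 k : `|\sum_(1 <= j < k.+1) mu j / j%:R| <= 2.
Proof.
case: k => [|k]; first by rewrite big_nil normr0.
have k0 : 0 < k.+1%:R :> R by rewrite ltr0n.
have k1 : 1 <= k.+1%:R :> R by rewrite ler1n.
rewrite -(ler_pM2l k0) -{1}(gtr0_norm k0) -normrM.
have -> : k.+1%:R * (\sum_(1 <= j < k.+2) mu j / j%:R) =
    \sum_(1 <= j < k.+2) mu j * (k.+1%:R / j%:R - (k.+1 %/ j)%:R) + 1.
  rewrite -[X in _ = _ + X](@sum_mu_divn k.+1)// -big_split/= big_distrr/=.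
  by apply: eq_bigr => j _; ring.
rewrite (le_trans (ler_normD _ _))// normr1.
have := norm_sum_mu_divn_sub k.+1 k.+1; lra.
Qed.

Lemma sumr_const_nat_minn (c : R) q b :
  \sum_(1 <= i < b.+1 | (i <= q)%N) c = c *+ minn q b.
Proof.
elim: b => [|b IH]; first by rewrite big_nil minn0.
rewrite big_mkcond big_nat_recr//= -big_mkcond/= IH.
case: (ltnP b q) => bq; last by rewrite addr0 !(minn_idPl _)// ltnW.
by rewrite !(minn_idPr _) ?mulrSr// ltnW.
Qed.

(* The sum equals \sum_j mu j * min (N %/ j, b), to be compared with
   \sum_j mu j * (N %/ j) = 1; they differ only for j <= N %/ b. *)
Lemma norm_sum_mertens_div N b : (0 < N)%N -> (0 < b)%N ->
  `|\sum_(1 <= n < b.+1) mertens (N %/ n)| <= 5 * N%:R.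
Proof.
move=> N0 b0.
(* The minimum of [N %/ j] and [b] is written with truncated subtraction, so that the second sum
   stops at [k = N %/ b]. *)
have -> : \sum_(1 <= n < b.+1) mertens (N %/ n) =
   \sum_(1 <= j < N.+1) mu j * (N %/ j)%:R - \sum_(1 <= j < N.+1) mu j * (N %/ j - b)%:R.
  rewrite -sumrB; transitivity (\sum_(1 <= n < b.+1) \sum_(1 <= j < N.+1)
      if (n * j <= N)%N then mu j else 0).
    by apply: eq_big_nat => n /andP[n0 _]; rewrite -big_mkcond/= -sum_nat_div.
  rewrite exchange_big_nat/=; apply: eq_big_nat => j /andP[j0 _].
  rewrite -mulrBr -natrB ?leq_subr// -[(_ - (_ - _))%N]/((N %/ j - (N %/ j - b))%N).
  rewrite -minnE -big_mkcond/= mulr_natr.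
  by under eq_bigl do rewrite -leq_divRL//; exact: sumr_const_nat_minn.
set k := (N %/ b)%N.
have kN : (k <= N)%N := leq_div N b.
have kbN : b%:R * k%:R <= N%:R :> R by rewrite -natrM ler_nat mulnC leq_trunc_div.
have -> : \sum_(1 <= j < N.+1) mu j * (N %/ j - b)%:R =
    \sum_(1 <= j < k.+1) mu j * (N %/ j)%:R - b%:R * mertens k.
  rewrite -(@sum_nat_extend _ k)//; last first.
    move=> j; rewrite /k ltn_divLR// => Nj.
    have j0 : (0 < j)%N by case: j Nj; rewrite ?mul0n.
    have /eqP -> : (N %/ j - b == 0)%N; last by rewrite mulr0.
    by rewrite subn_eq0 -ltnS ltn_divLR// (leq_trans Nj)// mulnC leq_mul.
  rewrite /mertens big_distrr/= -sumrB.
  apply: eq_big_nat => j /andP[j0 jk].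
  rewrite natrB ?mulrBr 1?[mu j * b%:R]mulrC// leq_divRL//.
  by rewrite mulnC -leq_divRL.
have -> : \sum_(1 <= j < k.+1) mu j * (N %/ j)%:R =
    N%:R * (\sum_(1 <= j < k.+1) mu j / j%:R) -
    \sum_(1 <= j < k.+1) mu j * (N%:R / j%:R - (N %/ j)%:R).
  by rewrite big_distrr/= -sumrB; apply: eq_bigr => j _; ring.
(* The total is at most [1 + 2 * N + k + N], with [1 <= N] and [k <= N]. *)
rewrite sum_mu_divn//.
have h1 : `|b%:R * mertens k| <= N%:R.
  by rewrite normrM ger0_norm// (le_trans _ kbN)// ler_wpM2l// norm_mertens_le.
have h2 := norm_sum_mu_divn_sub N k.
have h3 : `|N%:R * (\sum_(1 <= j < k.+1) mu j / j%:R)| <= 2 * N%:R.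
  by rewrite normrM ger0_norm// mulrC ler_wpM2r// norm_sum_mu_div_le2.
have h4 : k%:R <= N%:R :> R by rewrite ler_nat.
have h5 : 1 <= N%:R :> R by rewrite ler1n.
move: h1 h2 h3; rewrite !ler_norml => /andP[? ?] /andP[? ?] /andP[? ?].
by apply/andP; split; lra.
Qed.

(** Neighbours with positive product share their sign, so one common sign factors out of the
    block. *)
Lemma ler_sum_norm_same_sign (f : nat -> R) u v :
  (forall n, (u <= n)%N -> (n.+1 < v)%N -> 0 < f n * f n.+1) ->
  \sum_(u <= n < v) `|f n| <= `|\sum_(u <= n < v) f n|.
Proof.
move=> same.
have sgE n : (u <= n)%N -> (n < v)%N -> Num.sg (f n) = Num.sg (f u).
  move/subnK => <-; elim: (n - u)%N => // j IH; rewrite addSn => jv.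
  rewrite -IH ?(ltnW jv)//; have := same (j + u)%N (leq_addl _ _) jv.
  rewrite -sgr_cp0 sgrM.
  by case: (sgrP (f (j + u)%N)); case: (sgrP (f (j + u).+1)) => // _ _ /eqP; lra.
rewrite big_nat (eq_bigr (fun n => Num.sg (f u) * f n)); last first.
  by move=> n /andP[un nv]; rewrite normrEsg sgE.
rewrite -big_nat -big_distrr/= (le_trans (ler_norm _))// normrM ler_piMl//.
by rewrite normr_sg; case: (_ != _).
Qed.

Lemma norm_le_sub_of_mul_le0 (x y : R) : x * y <= 0 -> `|x| <= `|x - y|.
Proof.
move=> xy; rewrite -ler_sqr ?nnegrE// !real_normK ?num_real//; nra.
Qed.

(** Each doubling from [m] to [2 * m] adds [m] terms, each at least [1 / (2 * m)]. *)
Lemma sum_inv_dyadic_ge a r : (0 < a)%N ->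
  r%:R / 2 <= \sum_(a.+1 <= n < (2 ^ r * a).+1) n%:R^-1 :> R.
Proof.
move=> a0; elim: r => [|r IH]; first by rewrite mul0r mul1n big_geq.
have h : (2 ^ r * a <= 2 ^ r.+1 * a)%N by rewrite leq_pmul2r// leq_pexp2l.
have h0 : (a <= 2 ^ r * a)%N by rewrite leq_pmull// expn_gt0.
rewrite (big_cat_nat (n := (2 ^ r * a).+1))//=.
rewrite -natr1 mulrDl mul1r lerD// {IH}.
rewrite expnS -mulnA; set m := (2 ^ r * a)%N.
have m0 : (0 < m)%N by rewrite muln_gt0 expn_gt0.
have : \sum_(m.+1 <= n < (2 * m).+1) (2 * m)%:R^-1 <= \sum_(m.+1 <= n < (2 * m).+1) n%:R^-1 :> R.
  rewrite big_nat [leRHS]big_nat; apply: ler_sum => n /andP[mn n2m].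
  have n0 : (0 < n)%N := leq_ltn_trans (leq0n _) mn.
  have m20 : (0 < 2 * m)%N by rewrite mul2n double_gt0.
  by rewrite lef_pV2 ?posrE ?ltr0n// ler_nat.
apply: le_trans; rewrite sumr_const_nat subSS mul2n -addnn addnK -[leRHS]mulr_natr natrD.
have : 0 < m%:R :> R by rewrite ltr0n.
move: (m%:R : R) => x x0; suff -> : (x + x)^-1 * x = 2^-1 by [].
by field; lra.
Qed.

Lemma sum_inv_le_lnB a b : (0 < a)%N -> (a <= b)%N ->
  \sum_(a.+1 <= n < b.+1) n%:R^-1 <= lnn b - lnn a.
Proof.
move=> a0; move/subnK => <-; elim: (b - a)%N => [|j IH].
  by rewrite add0n big_geq// subrr.
rewrite addSn big_nat_recr ?ltnS ?leq_addl//=.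
have := @lnnS_ge R (j + a)%N; rewrite addn_gt0 a0 orbT => /(_ isT).
by move: ((j + a).+1%:R^-1) IH => x; lra.
Qed.

End sign_changes.

(** * The gain on a single block *)

Section tauberian.
Context {R : realType}.
Local Notation mertens := (@mertens R).
Implicit Types (k N a : nat).

(** With a constant sign the moduli add up to the modulus of the sum, a difference of two initial
    sums of size at most [5 * N]. *)
Lemma block_no_sign_change N a r : (0 < N)%N -> (0 < a)%N ->
  (forall n, (a < n)%N -> (n < 2 ^ r * a)%N ->
     0 < mertens (N %/ n) * mertens (N %/ n.+1)) ->
  \sum_(a.+1 <= n < (2 ^ r * a).+1) `|mertens (N %/ n)| <= 10 * N%:R.
Proof.
move=> N0 a0 same; rewrite (le_trans (ler_sum_norm_same_sign _))//.
have aK : (a <= 2 ^ r * a)%N by rewrite leq_pmull// expn_gt0.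
have K0 : (0 < 2 ^ r * a)%N := leq_trans a0 aK.
have := @norm_sum_mertens_div R _ _ N0 K0; have := @norm_sum_mertens_div R _ _ N0 a0.
rewrite [\sum_(1 <= n < (2 ^ r * a).+1) _](big_cat_nat (n := a.+1))//=.
set s := \sum_(1 <= _ < _) _; set t := \sum_(_ <= _ < _) _.
rewrite !ler_norml => /andP[? ?] /andP[? ?]; apply/andP; split; lra.
Qed.

(** At a sign change the value is at most the jump, and the Lipschitz bound carries this to [n],
    giving [2 * (N / m - N / n + 1)]. The difference is at most [N / (n * q)] because
    [n - m <= m / q], and so is 1 because [n * q <= N]. *)
Lemma block_sign_change_window N m q n : (0 < m)%N -> (0 < q)%N ->
  mertens (N %/ m) * mertens (N %/ m.+1) <= 0 ->
  (m < n)%N -> (n <= m + m %/ q)%N -> (n * q <= N)%N ->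
  `|mertens (N %/ n)| <= 4 / q%:R * (N%:R / n%:R).
Proof.
move=> m0 q0 /norm_le_sub_of_mul_le0 hm mn nq nN.
have n0 : (0 < n)%N := ltn_trans m0 mn.
have n0R : 0 < n%:R :> R by rewrite ltr0n.
have m0R : 0 < m%:R :> R by rewrite ltr0n.
have q0R : 0 < q%:R :> R by rewrite ltr0n.
have h1 : `|mertens (N %/ m)| <= (N %/ m)%:R - (N %/ n)%:R.
  rewrite (le_trans hm)// (le_trans (mertens_lip (leq_div2l N m0 (leqnSn m))))//.
  by rewrite lerB// ler_nat leq_div2l.
have h2 : `|mertens (N %/ n)| <= 2 * ((N %/ m)%:R - (N %/ n)%:R).
  have := @mertens_lip R (N %/ n)%N (N %/ m)%N (leq_div2l N m0 (ltnW mn)).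
  rewrite distrC => h3; have := ler_normD (mertens (N %/ n) - mertens (N %/ m)) (mertens (N %/ m)).
  by rewrite subrK; lra.
have h4 : (N %/ m)%:R - (N %/ n)%:R <= N%:R / m%:R - N%:R / n%:R + 1 :> R.
  have := divn_natr_le (R := R) N m; have := @divn_natr_dist R N n n0.
  by rewrite ler_norml => /andP[? ?]; lra.
have h5 : 1 <= q%:R^-1 * (N%:R / n%:R) :> R.
  by rewrite mulrC -mulrA -invfM -natrM mulnC ler_pdivlMr ?ltr0n ?muln_gt0 ?q0// mul1r ler_nat mulnC.
have h6 : N%:R / m%:R - N%:R / n%:R <= q%:R^-1 * (N%:R / n%:R) :> R.
  have -> : N%:R / m%:R - N%:R / n%:R = (N%:R / n%:R) * ((n%:R - m%:R) / m%:R) :> R.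
    by field; rewrite !gt_eqF.
  rewrite mulrC ler_wpM2r ?divr_ge0// ler_pdivrMr// mulrC ler_pdivlMr//.
  by rewrite -natrB ?(ltnW mn)// -natrM ler_nat -leq_divRL// leq_subLR.
rewrite (le_trans h2)// -mulrA; lra.
Qed.

(* The gain al N / (8 q) comes from a window m < n <= m + m %/ q after a sign
   change at m, or, without sign change up to 2 ^ r * a, from the bound 10 N
   against be \sum N / n >= al r N / 2 >= 11 N. *)
Lemma block_sum_le N a r q Y (al be : R) : (0 < N)%N -> (0 < q)%N ->
  0 < al -> al <= be -> 8 <= al * q%:R -> 22 <= al * r%:R ->
  (forall k, (Y <= k)%N -> `|mertens k| <= be * k%:R) -> (q <= Y)%N ->
  (q <= a)%N -> (2 ^ r.+1 * a * Y <= N)%N -> al <= 1 ->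
  \sum_(a.+1 <= n < (2 ^ r.+1 * a).+1) `|mertens (N %/ n)| <=
  be * \sum_(a.+1 <= n < (2 ^ r.+1 * a).+1) N%:R / n%:R - al / (8 * q%:R) * N%:R.
Proof.
move=> N0 q0 al0 albe alq alr beY qY qa KN al1.
have a0 : (0 < a)%N := leq_trans q0 qa.
have q0R : 0 < q%:R :> R by rewrite ltr0n.
have q1R : 1 <= q%:R :> R by rewrite ler1n.
have N0R : 0 < N%:R :> R by rewrite ltr0n.
have be0 : 0 <= be by lra.
set c := al / _.
have bnd n : (a < n)%N -> (n <= 2 ^ r.+1 * a)%N ->
    `|mertens (N %/ n)| <= be * (N%:R / n%:R).
  move=> an nK; have n0 : (0 < n)%N := leq_ltn_trans (leq0n _) an.
  rewrite (le_trans (beY _ _)) ?ler_wpM2l ?divn_natr_le//.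
  by rewrite leq_divRL// mulnC (leq_trans _ KN)// leq_mul2r nK orbT.
have bnds u v : (a <= u)%N -> (v <= 2 ^ r.+1 * a)%N ->
    \sum_(u.+1 <= n < v.+1) `|mertens (N %/ n)| <=
    be * \sum_(u.+1 <= n < v.+1) N%:R / n%:R.
  move=> au vK; rewrite big_distrr/= big_nat [leRHS]big_nat.
  apply: ler_sum => n /andP[un nv]; apply: bnd.
    exact: leq_ltn_trans un.
  exact: leq_trans vK.
have aK : (a <= 2 ^ r * a)%N by rewrite leq_pmull// expn_gt0.
have KK : (2 ^ r * a <= 2 ^ r.+1 * a)%N by rewrite leq_pmul2r// leq_pexp2l.
(* Sign changes are sought only below [2 ^ r * a]: the window ends by [2 * m], hence inside the
   block. *)
have [[m /andP[am mK] change]|nochange] := pselect (exists2 m, (a < m < 2 ^ r * a)%N &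
     mertens (N %/ m) * mertens (N %/ m.+1) <= 0).
- set d := (m %/ q)%N; have m0 : (0 < m)%N := ltn_trans a0 am.
  have m0R : 0 < m%:R :> R by rewrite ltr0n.
  have qm : (q <= m)%N := leq_trans qa (ltnW am).
  have d0 : (0 < d)%N by rewrite divn_gt0.
  have mmd : (m <= m + d)%N := leq_addr d m.
  have md2 : (m + d <= 2 * m)%N by rewrite mul2n -addnn leq_add2l leq_div.
  have mdK : (m + d <= 2 ^ r.+1 * a)%N.
    by rewrite (leq_trans md2)// expnS -mulnA leq_mul2l ltnW.
  have mK' := leq_trans mmd mdK.
  have split3 (F : nat -> R) : \sum_(a.+1 <= n < (2 ^ r.+1 * a).+1) F n =
      \sum_(a.+1 <= n < m.+1) F n + (\sum_(m.+1 <= n < (m + d).+1) F n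
      + \sum_((m + d).+1 <= n < (2 ^ r.+1 * a).+1) F n).
    rewrite (big_cat_nat (n := m.+1))//=; last by rewrite ltnS ltnW.
    by congr (_ + _); rewrite (big_cat_nat (n := (m + d).+1)).
  rewrite !split3 !mulrDr.
  have h1 := bnds _ _ (leqnn a) mK'.
  have h3 := bnds _ _ (leq_trans (ltnW am) mmd) (leqnn _).
  set W := \sum_(m.+1 <= n < (m + d).+1) N%:R / n%:R.
  (* Since [8 <= al * q], the factor [4 / q] is at most [al / 2], which is at most half of [be]. *)
  have h2 : \sum_(m.+1 <= n < (m + d).+1) `|mertens (N %/ n)| <= al / 2 * W.
    rewrite /W big_distrr/= big_nat [leRHS]big_nat; apply: ler_sum => n /andP[mn nmd].
    rewrite (le_trans (block_sign_change_window m0 q0 change mn nmd _))//.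
      rewrite (leq_trans _ KN)// leq_mul// (leq_trans _ mdK)//.
    rewrite ler_wpM2r ?divr_ge0// ler_pdivrMr//; lra.
  (* The window has [d] terms, each at least [N / (2 * m)], and [m <= 2 * d * q] because the
     remainder of [m] modulo [q] is below [q]. *)
  have h4 : N%:R / (4 * q%:R) <= W.
    rewrite (@le_trans _ _ (\sum_(m.+1 <= n < (m + d).+1) N%:R / (2 * m%:R)))//.
      rewrite sumr_const_nat subSS addKn -[leRHS]mulr_natr -mulrA ler_pM2l//.
      rewrite [leRHS]mulrC ler_pdivlMr ?mulr_gt0// mulrC ler_pdivrMr ?mulr_gt0//.
      have : m%:R <= 2 * (d%:R * q%:R) :> R; last by lra.
      rewrite -!natrM ler_nat {1}(divn_eq m q) -/d mul2n -addnn leq_add2l.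
      by rewrite (leq_trans (ltnW (ltn_pmod m q0)))// leq_pmull.
    rewrite big_nat [leRHS]big_nat; apply: ler_sum => n /andP[mn nmd].
    have n0 : (0 < n)%N := leq_ltn_trans (leq0n _) mn.
    rewrite ler_pM2l// lef_pV2 ?posrE ?mulr_gt0 ?ltr0n// -natrM ler_nat.
    exact: leq_trans md2.
  have h5 : c * N%:R <= al / 2 * W.
    have -> : c * N%:R = al / 2 * (N%:R / (4 * q%:R)) by rewrite /c; field; rewrite gt_eqF.
    by rewrite ler_wpM2l// divr_ge0// ltW.
  have h6 : al * W <= be * W.
    by rewrite ler_wpM2r// /W sumr_ge0// => n _; rewrite divr_ge0.
  move: h1 h2 h3 h5 h6; clear.
  set s1 := \sum_(a.+1 <= n < m.+1) `|_|; set s2 := \sum_(m.+1 <= n < _) `|_|.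
  set s3 := \sum_((m + d).+1 <= n < _) `|_|.
  set t1 := be * \sum_(a.+1 <= n < m.+1) _; set t3 := be * \sum_((m + d).+1 <= n < _) _.
  lra.
- have same n : (a < n)%N -> (n < 2 ^ r * a)%N ->
      0 < mertens (N %/ n) * mertens (N %/ n.+1).
    move=> an nK; rewrite ltNge; apply/negP => le0; apply: nochange; exists n => //.
    by rewrite an.
  have c1 : c <= 1.
    by rewrite /c ler_pdivrMr ?mul1r ?mulr_gt0//; lra.
  have split2 (F : nat -> R) : \sum_(a.+1 <= n < (2 ^ r.+1 * a).+1) F n =
      \sum_(a.+1 <= n < (2 ^ r * a).+1) F n
      + \sum_((2 ^ r * a).+1 <= n < (2 ^ r.+1 * a).+1) F n.
    by rewrite (big_cat_nat (n := (2 ^ r * a).+1)).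
  rewrite !split2 mulrDr.
  have h1 := block_no_sign_change N0 a0 same.
  have h2 := bnds _ _ aK (leqnn _).
  have h3 := @sum_inv_dyadic_ge R a r a0.
  have h4 : 11 * N%:R <= be * (N%:R * \sum_(a.+1 <= n < (2 ^ r * a).+1) n%:R^-1).
    rewrite mulrCA [leRHS]mulrC ler_wpM2r//.
    rewrite (@le_trans _ _ (al * (r%:R / 2)))//; first by lra.
    by rewrite ler_pM// ?divr_ge0// ltW.
  have h5 : c * N%:R <= N%:R by rewrite ler_piMl.
  move: h4; rewrite big_distrr/=; move: h1 h2; lra.
Qed.
End tauberian.

(** * Summation over blocks and iteration of the gain *)

Section mertens_decay.
Context {R : realType}.
Local Notation lnn := (@lnn R).
Local Notation mertens := (@mertens R).
Implicit Types (k N : nat).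

Definition mertens_density_le (be : R) : Prop :=
  exists Y, forall k, (Y <= k)%N -> `|mertens k| <= be * k%:R.

Lemma lnnX k j : (0 < k)%N -> lnn (k ^ j) = j%:R * lnn k.
Proof. by move=> k0; rewrite /lnn natrX lnXn ?ltr0n// [RHS]mulr_natl. Qed.

Lemma weighted_blocks_sum_le (K q Y j0 : nat) (be c : R) : (1 < K)%N -> (q <= K ^ j0)%N ->
  0 <= be -> c <= be * lnn K ->
  (forall N a, (0 < N)%N -> (q <= a)%N -> (K * a * Y <= N)%N ->
    \sum_(a.+1 <= n < (K * a).+1) `|mertens (N %/ n)| <=
    be * \sum_(a.+1 <= n < (K * a).+1) N%:R / n%:R - c * N%:R) ->
  forall N J, (0 < N)%N -> (0 < Y)%N -> (j0 <= J)%N -> (K ^ J * Y <= N)%N ->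
  \sum_(1 <= n < (K ^ J).+1) lnn n * `|mertens (N %/ n)| <=
  lnn (K ^ j0) * (N%:R * (1 + lnn N)) +
  N%:R * (lnn K * (be * lnn K - c)) * (J%:R * (J%:R + 1) / 2).
Proof.
move=> K1 qK be0 cbe block N J N0 Y0.
have K0 := ltnW K1; have lK := lnn_ge0 (R := R) K.
have cbe' : 0 <= be * lnn K - c by rewrite subr_ge0.
move/subnK => <-; elim: (J - j0)%N => [|i IH].
  rewrite add0n => KN.
  have KjN : (K ^ j0 <= N)%N := leq_trans (leq_pmulr _ Y0) KN.
  (* At [J = j0] the triangular term is nonnegative, by [c <= be * ln K], and is dropped. *)
  apply: (@le_trans _ _ (lnn (K ^ j0) * (N%:R * (1 + lnn N)))); last first.
    by rewrite lerDl !mulr_ge0// ?addr_ge0// mulr_ge0.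
  apply: (@le_trans _ _ (\sum_(1 <= n < N.+1) lnn (K ^ j0) * (N %/ n)%:R)); last first.
    by rewrite -big_distrr/= ler_wpM2l ?lnn_ge0// sum_divn_le.
  rewrite [leRHS](big_cat_nat (n := (K ^ j0).+1))//=.
  rewrite -[leLHS]addr0 lerD//; last first.
    by rewrite sumr_ge0// => n _; rewrite mulr_ge0// lnn_ge0.
  rewrite big_nat [leRHS]big_nat; apply: ler_sum => n /andP[n0 nK].
  by rewrite ler_pM// ?lnn_ge0 ?ler_lnn ?norm_mertens_le.
rewrite addSn; set j := (i + j0)%N; move: IH; rewrite -/j => IH KN.
have Kj : (K ^ j <= K ^ j.+1)%N by rewrite leq_pexp2l.
have Kj0 : (0 < K ^ j)%N by rewrite expn_gt0 K0.
have {}IH := IH (leq_trans (leq_mul Kj (leqnn Y)) KN).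
have qj : (q <= K ^ j)%N by rewrite (leq_trans qK)// leq_pexp2l// leq_addl.
have := block N (K ^ j)%N N0 qj; rewrite -expnS => /(_ KN) blk.
rewrite (big_cat_nat (n := (K ^ j).+1))//= (le_trans (lerD IH (lexx _)))//.
rewrite -addrA lerD2l.
have h1 : \sum_((K ^ j).+1 <= n < (K ^ j.+1).+1) lnn n * `|mertens (N %/ n)| <=
   lnn (K ^ j.+1) * \sum_((K ^ j).+1 <= n < (K ^ j.+1).+1) `|mertens (N %/ n)|.
  rewrite big_distrr/= big_nat [leRHS]big_nat; apply: ler_sum => n /andP[n0 nK].
  by rewrite ler_wpM2r// ler_lnn.
have h2 : \sum_((K ^ j).+1 <= n < (K ^ j.+1).+1) `|mertens (N %/ n)| <=
   N%:R * (be * lnn K - c).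
  rewrite (le_trans blk)// -big_distrr/=.
  have := @sum_inv_le_lnB R (K ^ j)%N (K ^ j.+1)%N Kj0 Kj.
  rewrite !lnnX// -natr1 mulrDl mul1r addrAC subrr add0r => h.
  have : be * (N%:R * \sum_((K ^ j).+1 <= n < (K ^ j.+1).+1) n%:R^-1) <= be * (N%:R * lnn K).
    by rewrite ler_wpM2l// ler_wpM2l.
  lra.
have h3 : lnn (K ^ j.+1) * \sum_((K ^ j).+1 <= n < (K ^ j.+1).+1) `|mertens (N %/ n)| <=
  lnn (K ^ j.+1) * (N%:R * (be * lnn K - c)) by rewrite ler_wpM2l// lnn_ge0.
rewrite (le_trans (lerD (lexx _) (le_trans h1 h3)))// lnnX// -[j.+1%:R]natr1.
by rewrite le_eqVlt; apply/orP; left; apply/eqP; field.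
Qed.

(** The parameters [q], [r], [K] and [c] are chosen from [al] alone, so one [de] serves every
    [be >= al]. Only the thresholds depend on [be]. *)
Lemma mertens_density_step (al : R) : 0 < al -> al <= 1 ->
  exists2 de : R, 0 < de & forall be, al <= be -> be <= 1 ->
    mertens_density_le be -> mertens_density_le (be - de).
Proof.
move=> al0 al1.
have [q alq] : exists q : nat, 8 <= al * q%:R.
  exists (Num.truncn (8 / al)).+1; rewrite mulrC -ler_pdivrMr// ltW//.
  by rewrite truncnS_gt.
have [r alr] : exists r : nat, 22 <= al * r%:R.
  exists (Num.truncn (22 / al)).+1; rewrite mulrC -ler_pdivrMr// ltW//.
  by rewrite truncnS_gt.
have q0 : (0 < q)%N by case: q alq => //; rewrite mulr0; lra.
have q1R : 1 <= q%:R :> R by rewrite ler1n.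
pose K := (2 ^ r.+1)%N.
have K1 : (1 < K)%N by rewrite -(expn0 2) ltn_exp2l.
have lK0 : 0 < lnn K by rewrite /lnn ln_gt0// ltr1n.
pose c := al / (8 * q%:R).
have c0 : 0 < c by rewrite divr_gt0// mulr_gt0//; lra.
have cK : c <= al * lnn K.
  have l2 : 2^-1 <= lnn K.
    have := @lnnS_ge R 1 isT; rewrite [lnn 1]ln1 subr0 => /le_trans; apply.
    exact: ler_lnn.
  rewrite ler_wpM2l ?(ltW al0)// (le_trans _ l2)// lef_pV2 ?posrE ?mulr_gt0//; lra.
have [B [B0 HB]] := @mertens_selberg_inequality R.
(* The leading coefficient drops by [c / ln K]; half of this is kept, the other half absorbs the O(N
   ln N) terms. *)
exists (c / (2 * lnn K)); first by rewrite divr_gt0// mulr_gt0.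
move=> be albe be1 [Y0 HY0]; pose Y := maxn Y0 q.
have HY k : (Y <= k)%N -> `|mertens k| <= be * k%:R.
  by move=> Yk; apply: HY0; rewrite (leq_trans _ Yk)// leq_maxl.
have qY : (q <= Y)%N by rewrite leq_maxr.
have Ypos : (0 < Y)%N := leq_trans q0 qY.
have [j0 qj0] : exists j0, (q <= K ^ j0)%N by exists q; rewrite ltnW// ltn_expl.
have be0 : 0 <= be by lra.
have cbe : c <= be * lnn K by rewrite (le_trans cK)// ler_wpM2r// ltW.
have := @weighted_blocks_sum_le K q Y j0 be c K1 qj0 be0 cbe.
have block N a : (0 < N)%N -> (q <= a)%N -> (K * a * Y <= N)%N ->
    \sum_(a.+1 <= n < (K * a).+1) `|mertens (N %/ n)| <=
    be * \sum_(a.+1 <= n < (K * a).+1) N%:R / n%:R - c * N%:R.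
  by move=> N0 qa KaN; apply: block_sum_le albe alq alr HY qY qa KaN al1.
move=> /(_ block) {block} main.
pose D := lnn (K ^ j0).
have D0 : 0 <= D by exact: lnn_ge0.
pose B' := 2 * D + 2 * (K%:R * Y%:R) + be * lnn K + B.
have B'0 : 0 <= B'.
  by rewrite /B' !addr_ge0 ?mulr_ge0// ltW.
have bound N : (K ^ j0 * Y <= N)%N ->
   `|mertens N| * lnn N ^+ 2 <=
   N%:R * ((be - c / lnn K) * lnn N ^+ 2 + B' * (1 + lnn N)).
  move=> KN; have N0 : (0 < N)%N.
    by rewrite (leq_trans _ KN)// muln_gt0 Ypos expn_gt0 ltnW.
  have NY : (0 < N %/ Y)%N.
    by rewrite divn_gt0// (leq_trans _ KN)// leq_pmull// expn_gt0 ltnW.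
  set J := trunc_log K (N %/ Y); have /andP[J1 J2] := trunc_log_bounds K1 NY.
  have j0J : (j0 <= J)%N by rewrite trunc_log_max// leq_divRL.
  rewrite leq_divRL// in J1; rewrite ltn_divLR// in J2.
  have T1 := main N J N0 Ypos j0J J1.
  have KJN : (K ^ J <= N)%N by rewrite (leq_trans _ J1)// leq_pmulr.
  (* By maximality of [J], [N %/ n] is below [K * Y] past [K ^ J], so the tail is only O(N ln N). *)
  have T2 : \sum_((K ^ J).+1 <= n < N.+1) lnn n * `|mertens (N %/ n)| <=
      N%:R * (lnn N * (K%:R * Y%:R)).
    apply: (@le_trans _ _ (\sum_((K ^ J).+1 <= n < N.+1) lnn N * (K%:R * Y%:R))).
      rewrite big_nat [leRHS]big_nat; apply: ler_sum => n /andP[Kn nN].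
      rewrite ler_pM ?lnn_ge0 ?ler_lnn// (le_trans (norm_mertens_le _))//.
      rewrite -natrM ler_nat ltnW// ltn_divLR ?(leq_ltn_trans _ Kn)//.
      rewrite (leq_trans J2)// expnSr -mulnA mulnC leq_mul2l.
      by rewrite (ltnW Kn) orbT.
    rewrite sumr_const_nat subSS -[leLHS]mulr_natl ler_wpM2r ?ler_nat ?leq_subr//.
    by rewrite !mulr_ge0// lnn_ge0.
  rewrite (le_trans (HB N N0))//.
  rewrite (big_cat_nat (n := (K ^ J).+1))//=.
  have lN : 0 <= lnn N by exact: lnn_ge0.
  have Jl : J%:R * lnn K <= lnn N by rewrite -lnnX ?(ltnW K1)// ler_lnn.
  (* The 2 of Selberg's inequality has cancelled that of the triangular number, and
     [J * ln K <= ln N] produces [ln N ^ 2] up to a linear term. *)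
  have T3 : lnn K * (be * lnn K - c) * (J%:R * (J%:R + 1)) <=
      (be - c / lnn K) * lnn N ^+ 2 + be * lnn K * (1 + lnn N).
    have -> : lnn K * (be * lnn K - c) * (J%:R * (J%:R + 1)) =
      (be - c / lnn K) * ((J%:R * lnn K) * (J%:R * lnn K + lnn K)).
      by field; rewrite gt_eqF.
    have b0 : 0 <= be - c / lnn K by rewrite subr_ge0 ler_pdivrMr.
    apply: (@le_trans _ _ ((be - c / lnn K) * (lnn N * (lnn N + lnn K)))).
      rewrite ler_wpM2l// ler_pM ?mulr_ge0 ?addr_ge0 ?mulr_ge0 ?(ltW lK0)// lerD2r//.
    rewrite mulrDr mulrDr -expr2 lerD2l.
    have -> : (be - c / lnn K) * (lnn N * lnn K) = (be * lnn K - c) * lnn N.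
      by field; rewrite gt_eqF.
    have h1 : 0 <= c * lnn N by rewrite mulr_ge0// ltW.
    have h2 : 0 <= be * lnn K by rewrite mulr_ge0// ltW.
    move: (be * lnn K) h2 => bk; lra.
  have NR : 0 <= N%:R :> R by [].
  have T3' := ler_wpM2l NR T3.
  have T4 : 0 <= N%:R * (K%:R * Y%:R) :> R by rewrite !mulr_ge0.
  rewrite -/D in T1; rewrite /B'.
  move: T1 T2 T3' T4; clear.
  set t1 : R := \sum_(1 <= n < _) _; set t2 : R := \sum_(_ <= n < N.+1) _.
  move: t1 t2 (c / lnn K) (lnn N) (lnn K) (N%:R : R) (K%:R : R) (Y%:R : R) (J%:R : R) => t1 t2 x l k n K' Y' j.
  move=> T1 T2 T3 T4; lra.
(* For [ln N >= 1] one has [1 + ln N <= 2 * ln N], so the second condition bounds the error by half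
   of the gain. *)
have [Z HZ] : exists Z : nat, forall N, (Z <= N)%N ->
   1 <= lnn N /\ 2 * B' <= c / (2 * lnn K) * lnn N.
  pose X := Num.max 1 (2 * B' / (c / (2 * lnn K))).
  exists (Num.truncn (expR X)).+1 => N ZN.
  have eN : expR X <= N%:R by rewrite (le_trans (ltW (truncnS_gt _)))// ler_nat.
  have : X <= lnn N by rewrite -[leLHS]expRK ler_ln// posrE ?expR_gt0// (lt_le_trans (expR_gt0 _) eN).
  rewrite ge_max => /andP[? ?]; split => //.
  have cl : 0 < c / (2 * lnn K) by rewrite divr_gt0// mulr_gt0.
  by rewrite [leRHS]mulrC -ler_pdivrMr.
exists (maxn Z (K ^ j0 * Y)%N) => N; rewrite geq_max => /andP[/HZ[l1 lB] /bound].
have l20 : 0 < lnn N ^+ 2 by rewrite exprn_gt0//; lra.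
rewrite -ler_pdivlMr// => /le_trans; apply.
rewrite ler_pdivrMr//.
have -> : (be - c / (2 * lnn K)) * N%:R * lnn N ^+ 2 =
    N%:R * ((be - c / (2 * lnn K)) * lnn N ^+ 2) by ring.
rewrite ler_wpM2l//.
move: lB; have -> : c / (2 * lnn K) = c / lnn K / 2 by field; rewrite gt_eqF.
move: (c / lnn K) => x; move: (lnn N) l1 => l l1 h; nra.
Qed.

(** The descent starts at the trivial density 1 and lowers it by [de] each time; the maximum with
    [al] halts it where the step ceases to apply. *)
Lemma mertens_density_le_pos (al : R) : 0 < al -> al <= 1 -> mertens_density_le al.
Proof.
move=> al0 al1; have [de de0 step] := mertens_density_step al0 al1.
have mono (b b' : R) : b <= b' -> mertens_density_le b -> mertens_density_le b'.
  by move=> bb [Y HY]; exists Y => k /HY /le_trans; apply; rewrite ler_wpM2r.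
have iter j : mertens_density_le (Num.max al (1 - j%:R * de)).
  elim: j => [|j IH].
    rewrite mul0r subr0; apply: (mono 1); first by rewrite le_max lexx orbT.
    by exists 0 => k _; rewrite mul1r norm_mertens_le.
  have [jal|jal] := leP (1 - j%:R * de) al.
    by apply: (mono (Num.max al (1 - j%:R * de))) => //; rewrite (max_idPl jal) le_max lexx.
  move: IH; rewrite (max_idPr (ltW jal)) => /(step _ (ltW jal)).
  have h : 0 <= j%:R * de by rewrite mulr_ge0// ltW.
  rewrite gerBl h => /(_ isT); apply: mono.
  by rewrite le_max -natr1 mulrDl mul1r opprD addrA lexx orbT.
(* More than [1 / de] steps bring [1 - j * de] below [al]. *)
have := iter (Num.truncn (1 / de)).+1.
rewrite (max_idPl _)// lerBlDr -lerBlDl.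
rewrite -ler_pdivrMr// ltW// (le_lt_trans _ (truncnS_gt _))// ler_pM2r ?invr_gt0//.
by rewrite gerBl ltW.
Qed.

End mertens_decay.

(** * Passage to the limit *)

Theorem corollary1 (R : realType) : H x @[x --> (+oo : set_system R)] --> (0 : R).
Proof.
apply/cvgrPdist_le => e e0.
have a0 : 0 < Num.min e 1 by rewrite lt_min e0 ltr01.
have a1 : Num.min e 1 <= 1 by rewrite ge_min lexx orbT.
have [Y HY] := mertens_density_le_pos a0 a1.
(* Beyond [Y ^ 2] one has [Y <= sqrt x <= expR (sqrt x)], so the integer part at which [mertens] is
   taken is at least [Y]. *)
exists (Y%:R ^+ 2); split; first exact: num_real.
move=> x Yx; rewrite sub0r normrN /H; set s := Num.sqrt x.
have Ys : Y%:R <= s by rewrite -[leLHS](ger0_norm (ler0n _ _)) -sqrtr_sqr ler_sqrt ?ltW // (le_lt_trans _ Yx)// sqr_ge0.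
have Yt : (Y <= Num.truncn (expR s))%N.
  rewrite truncn_ge_nat ?expR_ge0// (le_trans Ys)//.
  by rewrite (le_trans _ (expR_ge1Dx _))// lerDr.
have /le_trans h := HY _ Yt.
rewrite normrM (ger0_norm (expR_ge0 _)) expRN mulrC ler_pdivrMr ?expR_gt0//.
apply: h; apply: ler_pM; [exact: ltW|exact: ler0n|by rewrite ge_min lexx|].
by rewrite truncn_le expR_ge0.
Qed.
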